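(* Let $n\ge1$ be an integer and $q=p^m$ with $p$ a prime number and $m\ge1$. There exists a twist $J$ for the group algebra $\mathbb{C}\,\mathrm{PSL}_{2n+1}(q)$, arising from a $2$-cocycle on an abelian subgroup, such that the complex semisimple Hopf algebra $(\mathbb{C}\,\mathrm{PSL}_{2n+1}(q))_J$ does not admit a Hopf order over any number ring.
   Context: A number ring here means the ring of integers $R\subset\mathbb{C}$ of a number field contained in $\mathbb{C}$. Hopf orders. Let $H$ be a finite-dimensional Hopf algebra over a field $K$ (here $K=\mathbb{C}$) and $R$ a subring of $K$. A Hopf order of $H$ over $R$ is a finitely generated projective $R$-submodule $X$ of $H$ such that the natural map $X\otimes_R K\to H$ is an isomorphism and $1_H\in X$, $XX\subseteq X$, $\Delta(X)\subseteq X\otimes_R X$ (viewed inside $H\otimes_K H$), $\varepsilon(X)\subseteq R$, $S(X)\subseteq X$, where $\Delta,\varepsilon,S$ are the coproduct, counit and antipode of $H$. Twists. Let $G$ be a finite group and $M$ an abelian subgroup. Let $\widehat{M}$ be the group of characters $M\to\mathbb{C}^\times$ and, for $\phi\in\widehat{M}$, $e_\phi=\frac1{|M|}\sum_{m\in M}\phi(m^{-1})m$. A twist of $\mathbb{C}G$ arising from a $2$-cocycle on the abelian subgroup $M$ is an element $J=\sum_{\phi,\psi\in\widehat{M}}\omega(\phi,\psi)e_\phi\otimes e_\psi$, where $\omega:\widehat{M}\times\widehat{M}\to\mathbb{C}^\times$ is a normalized $2$-cocycle. The Hopf algebra $(\mathbb{C}G)_J$ equals $\mathbb{C}G$ as an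 algebra, with the same counit, coproduct $\Delta_J(h)=J\Delta(h)J^{-1}$ and antipode $S_J(h)=U_JS(h)U_J^{-1}$, where $U_J=\sum_\phi\omega(\phi,\phi^{-1})e_\phi$. $\mathrm{PSL}_{2n+1}(q)$ is the projective special linear group over the field $\mathbb{F}_q$ with $q$ elements. *)

(* Defs.v *)
From HB Require Import structures.
From mathcomp Require Import all_boot all_order all_algebra all_fingroup.
From mathcomp Require Import all_solvable all_field all_character.
From mathcomp Require Import boolp classical_sets.
Set Implicit Arguments.
Unset Strict Implicit.
Unset Printing Implicit Defensive.
Import GRing.Theory Num.Theory VectorInternalTheory.
Local Open Scope ring_scope.

Section TensorSpace.
Variable K : fieldType.
Implicit Types U V W : vectType K.

(* U ⊗ V is realised by the matrices of coordinates in the canonical bases of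
   U and V: u ⊗ v is the product of the coordinate column of u by the
   coordinate row of v, and tlift f is the linear map induced by a bilinear f
   (see tliftE and tens_ext for the universal property). *)
Definition tensor U V : Type := 'M[K]_(dim U, dim V).

HB.instance Definition _ U V := Vector.on (tensor U V).

Definition tens U V (u : U) (v : V) : tensor U V := (v2r u)^T *m v2r v.

Definition vect_basis U (i : 'I_(dim U)) : U := r2v (delta_mx 0 i).

Definition tlift U V W (f : U -> V -> W) (t : tensor U V) : W :=
  \sum_i \sum_j t i j *: f (vect_basis i) (vect_basis j).

Definition tmap U V U' V' (f : U -> U') (g : V -> V') :
    tensor U V -> tensor U' V' :=
  tlift (fun u v => tens (f u) (g v)).

Definition tassoc U V W : tensor (tensor U V) W -> tensor U (tensor V W) :=
  tlift (fun t w => tlift (fun u v => tens u (tens v w)) t).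

Definition bilin U V W (f : U -> V -> W) :=
  (forall v, linear (f^~ v)) /\ (forall u, linear (f u)).

Section LinearFacts.
Variables (U V : lmodType K) (f : U -> V).
Hypothesis fL : linear f.
Lemma lin0 : f 0 = 0.
Proof. by have := fL (-1) 0 0; rewrite scaler0 addr0 scaleN1r addNr. Qed.
Lemma linD x y : f (x + y) = f x + f y.
Proof. by have := fL 1 x y; rewrite !scale1r. Qed.
Lemma linZ a x : f (a *: x) = a *: f x.
Proof. by have := fL a x 0; rewrite lin0 !addr0. Qed.
Lemma lin_sum I (r : seq I) (P : pred I) (F : I -> U) :
  f (\sum_(i <- r | P i) F i) = \sum_(i <- r | P i) f (F i).
Proof. exact: (big_morph f linD lin0). Qed.
End LinearFacts.

Lemma tens_coef U V (u : U) (v : V) i j :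
  (tens u v : 'M_(_, _)) i j = v2r u 0 i * v2r v 0 j.
Proof. by rewrite /tens !mxE big_ord1 !mxE. Qed.

Lemma tens_bilin U V : bilin (@tens U V).
Proof.
split=> [v|u] a x y; apply/matrixP => i j.
all: rewrite !mxE !big_ord1 !mxE linearP !mxE.
  by rewrite mulrDl mulrA.
by rewrite mulrDr mulrCA.
Qed.

Lemma vectE U (u : U) : u = \sum_i v2r u 0 i *: vect_basis i.
Proof.
rewrite -[LHS]v2rK [X in r2v X]row_sum_delta linear_sum /=.
by apply: eq_bigr => i _; rewrite linearZ.
Qed.

Lemma tensE U V (t : tensor U V) :
  t = \sum_i \sum_j t i j *: tens (vect_basis i) (vect_basis j).
Proof.
rewrite {1}[t]matrix_sum_delta; apply: eq_bigr => i _; apply: eq_bigr => j _.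
congr (_ *: _); rewrite /tens /vect_basis !r2vK trmx_delta.
by rewrite mul_delta_mx.
Qed.

Lemma tlift_linear U V W (f : U -> V -> W) : linear (tlift f).
Proof.
move=> a s t; rewrite /tlift scaler_sumr -big_split; apply: eq_bigr => i _ /=.
rewrite scaler_sumr -big_split; apply: eq_bigr => j _ /=.
by rewrite !mxE scalerDl scalerA.
Qed.

Lemma tliftE U V W (f : U -> V -> W) u v :
  bilin f -> tlift f (tens u v) = f u v.
Proof.
case=> fL fR; rewrite [in RHS](vectE u) (lin_sum (fL v)).
apply: eq_bigr => i _; rewrite (linZ (fL v)) [in RHS](vectE v).
rewrite (lin_sum (fR _)) scaler_sumr; apply: eq_bigr => j _.
by rewrite (linZ (fR _)) scalerA /tens !mxE big_ord1 !mxE.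
Qed.

Lemma tens_ext U V (W : lmodType K) (f g : tensor U V -> W) :
    linear f -> linear g ->
  (forall u v, f (tens u v) = g (tens u v)) -> f =1 g.
Proof.
move=> fL gL fg t; rewrite [t]tensE (lin_sum fL) (lin_sum gL).
apply: eq_bigr => i _; rewrite (lin_sum fL) (lin_sum gL).
by apply: eq_bigr => j _; rewrite (linZ fL) (linZ gL) fg.
Qed.

Lemma tlift_ext U V W (f g : U -> V -> W) : f =2 g -> tlift f =1 tlift g.
Proof. by move=> fg t; do 2![apply: eq_bigr => ? _]; rewrite fg. Qed.

Lemma lin_comp (U V W : lmodType K) (f : V -> W) (g : U -> V) :
  linear f -> linear g -> linear (f \o g).
Proof. by move=> fL gL a x y /=; rewrite gL fL. Qed.
Lemma id_linear (U : lmodType K) : linear (@id U). Proof. by []. Qed.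

Lemma bilin_comp U V U' V' W (f : U' -> V' -> W) (g : U -> U') (h : V -> V') :
  bilin f -> linear g -> linear h -> bilin (fun u v => f (g u) (h v)).
Proof.
by case=> fL fR gL hL; split=> [v|u] a x y /=; rewrite ?gL ?hL ?fL ?fR.
Qed.

Lemma bilin_lin U V W W' (f : W -> W') (g : U -> V -> W) :
  linear f -> bilin g -> bilin (fun u v => f (g u v)).
Proof.
by move=> fL [gL gR]; split=> [v|u] a x y /=; rewrite ?gL ?gR fL.
Qed.

Lemma tmap_linear U V U' V' (f : U -> U') (g : V -> V') : linear (tmap f g).
Proof. exact: tlift_linear. Qed.

Lemma tmapE U V U' V' (f : U -> U') (g : V -> V') u v :
  linear f -> linear g -> tmap f g (tens u v) = tens (f u) (g v).
Proof.
by move=> fL gL; rewrite /tmap tliftE //; apply: bilin_comp (tens_bilin _ _) _ _.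
Qed.

Lemma tlift_bilin U V W (X : vectType K) (f : U -> V -> X -> W) :
  (forall u v, linear (f u v)) ->
  bilin (fun t x => tlift (fun u v => f u v x) t).
Proof.
move=> fL; split=> [x|t] a s r; first exact: tlift_linear.
rewrite /tlift scaler_sumr -big_split; apply: eq_bigr => i _ /=.
rewrite scaler_sumr -big_split; apply: eq_bigr => j _ /=.
by rewrite fL scalerDr !scalerA mulrC.
Qed.

Lemma tassoc_linear U V W : linear (@tassoc U V W).
Proof. exact: tlift_linear. Qed.

Lemma tassocE U V W u v w :
  @tassoc U V W (tens (tens u v) w) = tens u (tens v w).
Proof.
have [tL tR] := tens_bilin V W; have [sL sR] := tens_bilin U (tensor V W).
rewrite /tassoc tliftE.
  by rewrite tliftE //; split=> [y|x] a r s /=; rewrite ?tL ?sL ?sR.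
by apply: tlift_bilin => x y a r s /=; rewrite tR sR.
Qed.

End TensorSpace.

Notation "x ⊗ y" := (tens x y) (at level 40, left associativity) : ring_scope.

Section TensorAlgebra.
Variables (K : fieldType) (A B : falgType K).
Implicit Types s t r : tensor A B.

Definition tone : tensor A B := 1 ⊗ 1.
(* (x ⊗ y)(x' ⊗ y') = xx' ⊗ yy', extended bilinearly (see tmulE). *)
Definition tmul s t : tensor A B :=
  tlift (fun x y => tlift (fun x' y' => (x * x') ⊗ (y * y')) t) s.

Lemma mul_bilin (C : falgType K) : bilin (fun x y : C => x * y).
Proof.
by split=> [v|u] a x y; rewrite ?mulrDl ?mulrDr -?scalerAl -?scalerAr.
Qed.

Lemma tmulE x y x' y' : tmul (x ⊗ y) (x' ⊗ y') = (x * x') ⊗ (y * y').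
Proof.
have [tL tR] := tens_bilin A B.
rewrite /tmul tliftE.
  rewrite tliftE //; split=> [v|u] a r s /=.
    by rewrite (mul_bilin A).2 tL.
  by rewrite (mul_bilin B).2 tR.
split=> [v|u] a r s.
  rewrite /tlift scaler_sumr -big_split; apply: eq_bigr => i _ /=.
  rewrite scaler_sumr -big_split; apply: eq_bigr => j _ /=.
  by rewrite (mul_bilin A).1 tL scalerDr !scalerA mulrC.
rewrite /tlift scaler_sumr -big_split; apply: eq_bigr => i _ /=.
rewrite scaler_sumr -big_split; apply: eq_bigr => j _ /=.
by rewrite (mul_bilin B).1 tR scalerDr !scalerA mulrC.
Qed.

Lemma tmul_bilin : bilin tmul.
Proof.
split=> [v|u] a r s; first exact: tlift_linear.
have tE w : tmul u w = \sum_i \sum_j (u : 'M_(_, _)) i j *: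
    tlift (fun x' y' => (vect_basis i * x') ⊗ (vect_basis j * y')) w by [].
rewrite !tE scaler_sumr -big_split; apply: eq_bigr => i _ /=.
rewrite scaler_sumr -big_split; apply: eq_bigr => j _ /=.
by rewrite tlift_linear scalerDr !scalerA mulrC.
Qed.

Lemma tmulA : associative tmul.
Proof.
have [tL tR] := tmul_bilin.
move=> r s t.
apply: (tens_ext (f := fun r => tmul r (tmul s t))
         (g := fun r => tmul (tmul r s) t)) => [a x y|a x y|x y].
- by rewrite tL.
- by rewrite !tL.
apply: (tens_ext (f := fun s => tmul (x ⊗ y) (tmul s t))
         (g := fun s => tmul (tmul (x ⊗ y) s) t)) => [a {}r {}s|a {}r {}s|x' y'].
- by rewrite tL tR.
- by rewrite tR tL.
apply: (tens_ext (f := fun t => tmul (x ⊗ y) (tmul (x' ⊗ y') t))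
   (g := fun t => tmul (tmul (x ⊗ y) (x' ⊗ y')) t))
   => [a {}r {}s|a {}r {}s|x'' y''].
- by rewrite !tR.
- by rewrite tR.
by rewrite !tmulE !mulrA.
Qed.

Lemma tmul1l : left_id tone tmul.
Proof.
have [tL tR] := tmul_bilin.
move=> t; apply: (tens_ext (f := tmul tone) (g := id)) => // x y.
by rewrite tmulE !mul1r.
Qed.

Lemma tmul1r : right_id tone tmul.
Proof.
have [tL tR] := tmul_bilin.
move=> t; apply: (tens_ext (f := tmul^~ tone) (g := id)) => // x y.
by rewrite tmulE !mulr1.
Qed.

Lemma tmulDl : left_distributive tmul +%R.
Proof. by move=> r s t; apply: (linD (tmul_bilin.1 t)). Qed.
Lemma tmulDr : right_distributive tmul +%R.
Proof. by move=> r s t; apply: (linD (tmul_bilin.2 r)). Qed.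

Lemma tone_neq0 : tone != 0.
Proof.
apply/eqP => /matrixP t0.
have nz (C : falgType K) : {i | v2r (1 : C) 0 i != 0}.
  apply: sigW; apply/existsP; apply: contraNT (oner_neq0 C) => /existsPn h.
  apply/eqP/v2r_inj; rewrite linear0; apply/rowP => i.
  by rewrite mxE; apply/eqP; move: (h i); rewrite negbK.
have [[i i0] [j j0]] := (nz A, nz B).
have /eqP := t0 i j; rewrite /tone /tens !mxE big_ord1 !mxE mulf_eq0.
by rewrite (negbTE i0) (negbTE j0).
Qed.

HB.instance Definition _ := GRing.Zmodule_isNzRing.Build (tensor A B)
  tmulA tmul1l tmul1r tmulDl tmulDr tone_neq0.

Lemma tscalerAl a s t : a *: (s * t) = (a *: s) * t.
Proof. by rewrite [RHS](linZ (tmul_bilin.1 t)). Qed.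
HB.instance Definition _ :=
  GRing.Lmodule_isLalgebra.Build K (tensor A B) tscalerAl.
Lemma tscalerAr a s t : a *: (s * t) = s * (a *: t).
Proof. by rewrite [RHS](linZ (tmul_bilin.2 s)). Qed.
HB.instance Definition _ :=
  GRing.Lalgebra_isAlgebra.Build K (tensor A B) tscalerAr.
HB.instance Definition _ := Algebra_isFalgebra.Build K (tensor A B).

Lemma tensM (x x' : A) (y y' : B) :
  (x ⊗ y) * (x' ⊗ y') = (x * x') ⊗ (y * y').
Proof. exact: tmulE. Qed.
Lemma tens1 : (1 : A) ⊗ (1 : B) = 1 :> tensor A B. Proof. by []. Qed.

End TensorAlgebra.


Record hopf_algebra (K : fieldType) (H : falgType K) := HopfAlgebra {
  comul : H -> tensor H H;
  counit : H -> K;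
  antipode : H -> H;
  comul_linear : linear comul;
  comul_morph : monoid_morphism comul;
  counit_linear : scalar counit;
  counit_morph : monoid_morphism counit;
  antipode_linear : linear antipode;
  coassociative : forall h,
    tassoc (tmap comul id (comul h)) = tmap id comul (comul h);
  counital_l : forall h, tlift (fun x y => counit x *: y) (comul h) = h;
  counital_r : forall h, tlift (fun x y => counit y *: x) (comul h) = h;
  antipode_l : forall h,
    tlift (fun x y => antipode x * y) (comul h) = (counit h)%:A;
  antipode_r : forall h,
    tlift (fun x y => x * antipode y) (comul h) = (counit h)%:A }.

Section GroupAlgebra.
Variables (K : fieldType) (gT : finGroupType).

Definition group_alg : Type := {ffun gT -> K}.
HB.instance Definition _ := Vector.copy group_alg {ffun gT -> K^o}.
Implicit Types x y z : group_alg.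

(* x : group_alg stands for \sum_g x g * g; the product is the convolution, so
   that gelt a * gelt b = gelt (a * b), see geltM. *)
Definition gelt (g : gT) : group_alg := [ffun h => (h == g)%:R].
Definition gmul x y : group_alg := [ffun h => \sum_g x g * y (g^-1 * h)%g].

Lemma galgD x y : x + y = [ffun g => x g + y g]. Proof. by []. Qed.
Lemma galgZ a x : a *: x = [ffun g => a * x g]. Proof. by []. Qed.
Lemma galg_addE x y g : (x + y) g = x g + y g. Proof. by rewrite galgD ffunE. Qed.
Lemma galg_scaleE a x g : (a *: x) g = a * x g. Proof. by rewrite galgZ ffunE. Qed.
Lemma galg0E g : (0 : group_alg) g = 0. Proof. exact: ffunE. Qed.
Lemma galg_sumE I (r : seq I) (P : pred I) (F : I -> group_alg) g :
  (\sum_(i <- r | P i) F i) g = \sum_(i <- r | P i) F i g.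
Proof. exact: (big_morph (fun x : group_alg => x g)
  (fun x y => galg_addE x y g) (galg0E g)). Qed.

Lemma galgE x : x = \sum_g x g *: gelt g.
Proof.
apply/ffunP => h; rewrite galg_sumE (bigD1 h) //= galg_scaleE ffunE eqxx mulr1.
by rewrite big1 ?addr0 // => g /negbTE gh; rewrite galg_scaleE ffunE eq_sym gh mulr0.
Qed.

Lemma galg_ext (W : lmodType K) (f g : group_alg -> W) :
  linear f -> linear g -> (forall a, f (gelt a) = g (gelt a)) -> f =1 g.
Proof.
move=> fL gL fg t; rewrite [t]galgE (lin_sum fL) (lin_sum gL).
by apply: eq_bigr => i _; rewrite (linZ fL) (linZ gL) fg.
Qed.

Lemma gmul_bilin : bilin (gmul : group_alg -> group_alg -> group_alg).
Proof.
split=> [v|u] a x y; apply/ffunP => h; rewrite !(galg_addE, galg_scaleE, ffunE).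
all: rewrite mulr_sumr -big_split; apply: eq_bigr => g _ /=.
all: rewrite !(galg_addE, galg_scaleE) ?mulrDl ?mulrDr ?mulrA //.
by rewrite [u g * a]mulrC.
Qed.

Lemma gmulE a b : gmul (gelt a) (gelt b) = gelt (a * b)%g.
Proof.
apply/ffunP => h; rewrite !ffunE (bigD1 a) //= !ffunE eqxx mul1r.
rewrite big1 ?addr0 => [|g /negbTE ga]; last by rewrite ffunE ga mul0r.
by rewrite -(inj_eq (mulgI a)) mulKVg.
Qed.

Lemma gmulA : associative gmul.
Proof.
have [tL tR] := gmul_bilin.
move=> r s t.
apply: (galg_ext (f := fun r => gmul r (gmul s t))
         (g := fun r => gmul (gmul r s) t)) => [a x y|a x y|x].
- by rewrite tL.
- by rewrite !tL.
apply: (galg_ext (f := fun s => gmul (gelt x) (gmul s t))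
         (g := fun s => gmul (gmul (gelt x) s) t)) => [a {}r {}s|a {}r {}s|x'].
- by rewrite tL tR.
- by rewrite tR tL.
apply: (galg_ext (f := fun t => gmul (gelt x) (gmul (gelt x') t))
   (g := fun t => gmul (gmul (gelt x) (gelt x')) t))
   => [a {}r {}s|a {}r {}s|x''].
- by rewrite !tR.
- by rewrite tR.
by rewrite !gmulE !mulgA.
Qed.
Lemma gmul1l : left_id (gelt 1%g) gmul.
Proof.
have [tL tR] := gmul_bilin.
move=> t; apply: (galg_ext (f := gmul (gelt 1%g)) (g := id)) => // x.
by rewrite gmulE mul1g.
Qed.
Lemma gmul1r : right_id (gelt 1%g) gmul.
Proof.
have [tL tR] := gmul_bilin.
move=> t; apply: (galg_ext (f := gmul^~ (gelt 1%g)) (g := id)) => // x.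
by rewrite gmulE mulg1.
Qed.
Lemma gmulDl : left_distributive gmul +%R.
Proof. by move=> r s t; apply: (linD (gmul_bilin.1 t)). Qed.
Lemma gmulDr : right_distributive gmul +%R.
Proof. by move=> r s t; apply: (linD (gmul_bilin.2 r)). Qed.
Lemma gelt1_neq0 : gelt 1%g != 0.
Proof.
apply/eqP => /ffunP/(_ 1%g)/eqP; rewrite galg0E ffunE eqxx oner_eq0 //.
Qed.

HB.instance Definition _ := GRing.Zmodule_isNzRing.Build group_alg
  gmulA gmul1l gmul1r gmulDl gmulDr gelt1_neq0.
Lemma gscalerAl a x y : a *: (x * y) = (a *: x) * y.
Proof. by rewrite [RHS](linZ (gmul_bilin.1 y)). Qed.
HB.instance Definition _ :=
  GRing.Lmodule_isLalgebra.Build K group_alg gscalerAl.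
Lemma gscalerAr a x y : a *: (x * y) = x * (a *: y).
Proof. by rewrite [RHS](linZ (gmul_bilin.2 x)). Qed.
HB.instance Definition _ :=
  GRing.Lalgebra_isAlgebra.Build K group_alg gscalerAr.
HB.instance Definition _ := Algebra_isFalgebra.Build K group_alg.

Lemma geltM a b : gelt a * gelt b = gelt (a * b)%g. Proof. exact: gmulE. Qed.
Lemma gelt1 : gelt 1%g = 1. Proof. by []. Qed.

Definition galg_comul x : tensor group_alg group_alg :=
  \sum_g x g *: (gelt g ⊗ gelt g).
Definition galg_counit x : K := \sum_g x g.
Definition galg_antipode x : group_alg := [ffun g => x (g^-1)%g].

Lemma galg_comul_linear : linear galg_comul.
Proof.
move=> a x y; rewrite /galg_comul scaler_sumr -big_split; apply: eq_bigr => g _.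
by rewrite galg_addE galg_scaleE scalerDl scalerA.
Qed.
Lemma galg_comulE g : galg_comul (gelt g) = gelt g ⊗ gelt g.
Proof.
rewrite /galg_comul (bigD1 g) //= ffunE eqxx scale1r big1 ?addr0 // => h.
by move=> /negbTE hg; rewrite ffunE hg scale0r.
Qed.
Lemma galg_counit_linear : scalar galg_counit.
Proof.
move=> a x y; rewrite /galg_counit mulr_sumr -big_split; apply: eq_bigr => g _.
by rewrite galg_addE galg_scaleE.
Qed.
Lemma galg_counitE g : galg_counit (gelt g) = 1.
Proof.
rewrite /galg_counit (bigD1 g) //= ffunE eqxx big1 ?addr0 // => h.
by move=> /negbTE hg; rewrite ffunE hg.
Qed.
Lemma galg_antipode_linear : linear galg_antipode.
Proof.
by move=> a x y; apply/ffunP => g; rewrite !(galg_addE, galg_scaleE, ffunE).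
Qed.
Lemma galg_antipodeE g : galg_antipode (gelt g) = gelt g^-1%g.
Proof. by apply/ffunP => h; rewrite !ffunE (can2_eq invgK invgK). Qed.

Lemma galg_ext2 (W : lmodType K) (f g : group_alg -> group_alg -> W) :
  (forall y, linear (f^~ y)) -> (forall x, linear (f x)) ->
  (forall y, linear (g^~ y)) -> (forall x, linear (g x)) ->
  (forall a b, f (gelt a) (gelt b) = g (gelt a) (gelt b)) -> f =2 g.
Proof.
move=> fL fR gL gR fg x y.
apply: (galg_ext (fL y) (gL y)) => a; exact: (galg_ext (fR _) (gR _)).
Qed.

Lemma galg_comul_morph : monoid_morphism galg_comul.
Proof.
split=> [|x y]; first by rewrite -gelt1 galg_comulE.
apply: (galg_ext2 (f := fun x y => galg_comul (x * y))
  (g := fun x y => galg_comul x * galg_comul y)) => {x y} [y|x|y|x|a b];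
  try by move=> a u v; rewrite ?mulrDl ?mulrDr -?scalerAl -?scalerAr
    !galg_comul_linear ?mulrDl ?mulrDr -?scalerAl -?scalerAr.
by rewrite geltM !galg_comulE tensM geltM.
Qed.

Lemma galg_counit_morph : monoid_morphism galg_counit.
Proof.
split=> [|x y]; first by rewrite -gelt1 galg_counitE.
apply: (galg_ext2 (W := K^o) (f := fun x y => galg_counit (x * y))
  (g := fun x y => galg_counit x * galg_counit y)) => {x y} [y|x|y|x|a b].
- by move=> a u v; rewrite mulrDl -scalerAl galg_counit_linear.
- by move=> a u v; rewrite mulrDr -scalerAr galg_counit_linear.
- by move=> a u v; rewrite galg_counit_linear mulrDl -mulrA.
- by move=> a u v; rewrite galg_counit_linear mulrDr mulrCA.
by rewrite geltM !galg_counitE mulr1.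
Qed.

Lemma galg_coassoc h : tassoc (tmap galg_comul id (galg_comul h))
  = tmap id galg_comul (galg_comul h).
Proof.
have cL := galg_comul_linear.
apply: (galg_ext (f := fun h => tassoc (tmap galg_comul id (galg_comul h)))
 (g := fun h => tmap id galg_comul (galg_comul h))) => [a x y|a x y|a].
- by rewrite cL tmap_linear tassoc_linear.
- by rewrite cL tmap_linear.
rewrite galg_comulE !tmapE // ?galg_comulE ?tassocE //.
Qed.

Lemma galg_lift_ext (f : group_alg -> group_alg -> group_alg)
    (g : group_alg -> group_alg) :
  bilin f -> linear g -> (forall a, f (gelt a) (gelt a) = g (gelt a)) ->
  forall h, tlift f (galg_comul h) = g h.
Proof.
move=> fB gL fg.
apply: (galg_ext (f := fun h => tlift f (galg_comul h))) => // [a x y|a].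
  by rewrite galg_comul_linear tlift_linear.
by rewrite galg_comulE tliftE.
Qed.

Lemma galg_counit_alg_linear : linear (fun h : group_alg => (galg_counit h)%:A : group_alg).
Proof. by move=> a x y; rewrite galg_counit_linear scalerDl scalerA. Qed.

Definition group_hopf : hopf_algebra group_alg.
Proof.
exists galg_comul galg_counit galg_antipode.
- exact: galg_comul_linear.
- exact: galg_comul_morph.
- exact: galg_counit_linear.
- exact: galg_counit_morph.
- exact: galg_antipode_linear.
- exact: galg_coassoc.
- apply: (galg_lift_ext (g := id)) => // [|a].
    split=> [v|u] a x y; first by rewrite galg_counit_linear scalerDl scalerA.
    by rewrite scalerDr !scalerA mulrC.
  by rewrite galg_counitE scale1r.
- apply: (galg_lift_ext (g := id)) => // [|a].
    split=> [v|u] a x y; first by rewrite scalerDr !scalerA mulrC.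
    by rewrite galg_counit_linear scalerDl scalerA.
  by rewrite galg_counitE scale1r.
- apply: (galg_lift_ext (g := fun h => (galg_counit h)%:A)) => [||a].
  + by apply: (bilin_comp (mul_bilin _)) => //; apply: galg_antipode_linear.
  + exact: galg_counit_alg_linear.
  + by rewrite galg_antipodeE galg_counitE geltM mulVg scale1r.
- apply: (galg_lift_ext (g := fun h => (galg_counit h)%:A)) => [||a].
  + by apply: (bilin_comp (mul_bilin _)) => //; apply: galg_antipode_linear.
  + exact: galg_counit_alg_linear.
  + by rewrite galg_antipodeE galg_counitE geltM mulgV scale1r.
Defined.

End GroupAlgebra.

Section Dual.
Variables (C : numClosedFieldType) (aT : finGroupType).

(* Such an f has no zero, hence is a morphism to the units of C. *)
Definition is_character (f : {ffun aT -> C}) :=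
  (f 1%g == 1) && [forall x, forall y, f (x * y)%g == f x * f y].

Record dual := Dual {
  dual_fun :> {ffun aT -> C};
  dual_subproof : is_character dual_fun }.

HB.instance Definition _ := [isSub for dual_fun].

Implicit Types phi psi : dual.

Lemma dual1 phi : phi 1%g = 1.
Proof. by have /andP[/eqP] := dual_subproof phi. Qed.
Lemma dualM phi x y : phi (x * y)%g = phi x * phi y.
Proof. by have /andP[_ /forallP/(_ x)/forallP/(_ y)/eqP] := dual_subproof phi. Qed.

Lemma dualX phi x n : phi (x ^+ n)%g = phi x ^+ n.
Proof. by elim: n => [|n IH]; rewrite ?dual1 // expgS dualM IH exprS. Qed.

Lemma dual_neq0 phi x : phi x != 0.
Proof.
apply/eqP => x0; have /eqP := dual1 phi.
by rewrite -(mulgV x) dualM x0 mul0r eq_sym oner_eq0.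
Qed.

Lemma dualV phi x : phi x^-1%g = (phi x)^-1.
Proof.
by apply: (mulfI (dual_neq0 phi x)); rewrite -dualM mulgV dual1 divff ?dual_neq0.
Qed.

(* The values of a character are roots of unity of order dividing #|aT|; hence
   there are finitely many characters. *)
Definition unity_roots : seq C :=
  sval (closed_field_poly_normal ('X^#|[set: aT]| - 1)).

Lemma dual_unity phi x : phi x \in unity_roots.
Proof.
rewrite /unity_roots; case: closed_field_poly_normal => r /= pE.
have : root ('X^#|[set: aT]| - 1) (phi x).
  by rewrite rootE !hornerE -dualX expg_cardG ?inE // dual1 subrr.
rewrite pE lead_coefXnsubC ?cardG_gt0 // scale1r root_prod_XsubC //.
Qed.

Definition dual_code phi : {ffun aT -> seq_sub unity_roots} :=
  [ffun x => SeqSub (dual_unity phi x)].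
Definition dual_decode (f : {ffun aT -> seq_sub unity_roots}) : option dual :=
  insub [ffun x => val (f x)].
Lemma dual_codeK : pcancel dual_code dual_decode.
Proof.
move=> phi; rewrite /dual_decode (_ : [ffun x => _] = dual_fun phi).
  exact: valK.
by apply/ffunP => x; rewrite !ffunE.
Qed.

HB.instance Definition _ := Finite.copy dual (pcan_type dual_codeK).

Lemma dual_oneP : is_character [ffun=> 1].
Proof.
by rewrite /is_character ffunE eqxx; do 2![apply/forallP => ?];
  rewrite !ffunE mulr1.
Qed.
Lemma dual_mulP phi psi : is_character [ffun x => phi x * psi x].
Proof.
rewrite /is_character ffunE !dual1 mulr1 eqxx; do 2![apply/forallP => ?].
by rewrite !ffunE !dualM mulrACA.
Qed.
Lemma dual_invP phi : is_character [ffun x => phi x^-1%g].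
Proof.
rewrite /is_character ffunE invg1 dual1 eqxx; do 2![apply/forallP => ?].
by rewrite !ffunE !dualV !dualM invfM.
Qed.
Definition dual_one := Dual dual_oneP.
Definition dual_mul phi psi := Dual (dual_mulP phi psi).
Definition dual_inv phi := Dual (dual_invP phi).

Lemma dual_eq phi psi : dual_fun phi =1 dual_fun psi -> phi = psi.
Proof. by move=> e; apply: val_inj; apply/ffunP. Qed.

Lemma dual_mulA : associative dual_mul.
Proof. by move=> f g h; apply: dual_eq => x; rewrite !ffunE mulrA. Qed.
Lemma dual_mul1 : left_id dual_one dual_mul.
Proof. by move=> f; apply: dual_eq => x; rewrite !ffunE mul1r. Qed.
Lemma dual_mulV : left_inverse dual_one dual_inv dual_mul.
Proof.
by move=> f; apply: dual_eq => x; rewrite !ffunE dualV mulVf ?dual_neq0.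
Qed.

HB.instance Definition _ :=
  Finite_isGroup.Build dual dual_mulA dual_mul1 dual_mulV.

Lemma dual1E x : (1%g : dual) x = 1. Proof. exact: ffunE. Qed.
Lemma dualME phi psi x : (phi * psi)%g x = phi x * psi x.
Proof. exact: ffunE. Qed.
Lemma dualVE phi x : (phi^-1)%g x = phi x^-1%g.
Proof. exact: ffunE. Qed.

End Dual.

Section Separation.
Variable C : numClosedFieldType.

Lemma diag_finite_order n (A : 'M[C]_n) N : (0 < N)%N ->
  iter N (mulmx A) 1%:M = 1%:M -> diagonalizable A.
Proof.
case: n A => [|n] A N0 AN.
  by exists 1%:M; rewrite ?unitmx1 //; apply/is_diag_mxP => -[].
apply/diagonalizableP.
have {}AN : A ^+ N = 1.
  by rewrite -[RHS]AN; elim: (N) => // k IH; rewrite exprS IH.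
have [r] := closed_field_poly_normal ('X^N - 1 : {poly C}).
rewrite lead_coefXnsubC // scale1r => rE; exists r.
  rewrite -separable_prod_XsubC -rE unlock derivB derivXn derivC subr0.
  rewrite -scaler_nat coprimepZr ?pnatr_eq0 -?lt0n //.
  rewrite coprimep_expr // coprimepX rootE !hornerE expr0n eqn0Ngt N0 sub0r.
  by rewrite oppr_eq0 oner_eq0.
rewrite -rE; apply: mxminpoly_min.
by rewrite rmorphB rmorphXn /= horner_mx_X rmorph1 AN subrr.
Qed.

Variable (aT : finGroupType).
Lemma dual_sumG (phi : dual C aT) : \sum_x phi x = (#|aT| * (phi == 1%g))%:R.
Proof.
  have [->|ne] := eqVneq phi 1%g.
  rewrite muln1 (eq_bigr (fun=> 1)) ?sumr_const // => x _.
  by rewrite dual1E.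
rewrite muln0; have [x x1] : exists x, phi x != 1.
  apply/existsP; apply: contraNT ne => /existsPn h; apply/eqP/dual_eq => x.
  by rewrite dual1E; apply/eqP/negPn/h.
apply: (@mulfI _ (phi x - 1)); first by rewrite subr_eq0.
rewrite mulr0 mulrBl mul1r mulr_sumr [X in _ - X](reindex_inj (mulgI x)) /=.
apply/eqP; rewrite subr_eq0; apply/eqP; apply: eq_bigr => y _.
by rewrite dualM.
Qed.

Hypothesis cAA : forall x y : aT, (x * y = y * x)%g.

Lemma dual_separates m : (forall phi : dual C aT, phi m = 1) -> m = 1%g.
Proof.
move=> trm; pose G := [set: aT]%G; pose rG := regular_repr C G.
have inG x : x \in G by rewrite inE.
have /codiagonalizableP [P Pu /allP Pd] :
  {in [seq rG x | x <- enum aT] &, forall f g, comm_mx f g} /\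
  (forall f, f \in [seq rG x | x <- enum aT] -> diagonalizable f).
  split=> [_ _ /mapP[x _ ->] /mapP[y _ ->]|_ /mapP[x _ ->]].
    by rewrite /comm_mx -!repr_mxM // cAA.
  apply: (@diag_finite_order _ _ #|G|); first exact: cardG_gt0.
  have rX k : iter k (mulmx (rG x)) 1%:M = rG (x ^+ k)%g.
    by elim: k => [|k IH]; rewrite ?repr_mx1 //= IH -repr_mxM // expgS.
  by rewrite rX expg_cardG // repr_mx1.
pose D x := P *m rG x *m invmx P.
have DM x y : D (x * y)%g = D x *m D y.
  by rewrite /D repr_mxM // !mulmxA mulmxKV.
have D1 : D 1%g = 1%:M by rewrite /D repr_mx1 mulmx1 mulmxV.
have Ddiag x i j : i != j -> D x i j = 0.
  move=> ij; have hd : similar_diag P (rG x).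
    by apply: Pd; apply/mapP; exists x; rewrite ?mem_enum.
  by have := elimT (similar_diagP (rG x) Pu) hd; apply.
have chP i : is_character [ffun x => D x i i].
  rewrite /is_character ffunE D1 [X in X == _]mxE !eqxx; do 2![apply/forallP => ?].
  rewrite !ffunE DM [X in X == _]mxE (bigD1 i) //= big1 ?addr0 // => j ji.
  by rewrite Ddiag ?mul0r // eq_sym.
have Dm : D m = 1%:M.
  apply/matrixP => i j; rewrite [RHS]mxE; have [<-|ij] := eqVneq i j; last by rewrite Ddiag.
  by have := trm (Dual (chP i)); rewrite ffunE.
have : rG m = rG 1%g.
  rewrite repr_mx1 -[rG m](mulKmx Pu) -[_ *m rG m](mulmxK (_ : invmx P \in _)).
    by rewrite invmxK -/(D m) Dm mul1mx mulVmx.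
  by rewrite unitmx_inv.
by apply: (mx_faithful_inj (regular_mx_faithful C G)).
Qed.

Lemma dual_sum m : \sum_(phi : dual C aT) phi m = (#|aT| * (m == 1%g))%:R.
Proof.
have sum0 x : x != 1%g -> \sum_(phi : dual C aT) phi x = 0.
  move=> x1; have [psi psix] : exists psi : dual C aT, psi x != 1.
    apply/existsP; apply: contraNT x1 => /existsPn h; apply/eqP.
    by apply: dual_separates => phi; apply/eqP/negPn/h.
  apply: (@mulfI _ (psi x - 1)); first by rewrite subr_eq0.
  rewrite mulr0 mulrBl mul1r mulr_sumr [X in _ - X](reindex_inj (mulgI psi)) /=.
  apply/eqP; rewrite subr_eq0; apply/eqP; apply: eq_bigr => y _.
  by rewrite dualME.
have [->|m1] := eqVneq m 1%g; last by rewrite muln0 sum0.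
rewrite muln1.
have : \sum_x \sum_(phi : dual C aT) phi x = #|aT|%:R.
  rewrite exchange_big (bigD1 (1%g : dual C aT)) // dual_sumG eqxx muln1 big1 => [|phi].
    by rewrite /= addr0.
  by move=> /negbTE ne; rewrite dual_sumG ne muln0.
by rewrite (bigD1 1%g) //= [X in _ + X]big1 ?addr0.
Qed.

End Separation.

Definition normalized_2cocycle (C : fieldType) (A : finGroupType)
    (omega : A -> A -> C) : Prop :=
  [/\ forall x y, omega x y != 0,
      forall x, omega x 1%g = 1,
      forall x, omega 1%g x = 1
    & forall x y z,
        omega x y * omega (x * y)%g z = omega y z * omega x (y * z)%g].

Section TensorMorphisms.
Variable K : fieldType.
Implicit Types A B D : falgType K.

Lemma tlift_morph A B D (f : A -> B -> D) :
    bilin f ->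
    (forall x x' y y', f (x * x') (y * y') = f x y * f x' y') ->
  {morph tlift f : s t / s * t}.
Proof.
move=> fB fM s t; have fL := @tlift_linear K A B D f.
apply: (tens_ext (f := fun s => tlift f (s * t))
          (g := fun s => tlift f s * tlift f t)) => [a x y|a x y|x y].
- by rewrite mulrDl -scalerAl fL.
- by rewrite fL mulrDl -scalerAl.
apply: (tens_ext (f := fun t => tlift f ((x ⊗ y) * t))
          (g := fun t => tlift f (x ⊗ y) * tlift f t)) => [a u v|a u v|u v].
- by rewrite mulrDr -scalerAr fL.
- by rewrite fL mulrDr -scalerAr.
by rewrite tensM !tliftE.
Qed.

Lemma tmap_morph A B A' B' (f : A -> A') (g : B -> B') :
    linear f -> linear g -> {morph f : x y / x * y} -> {morph g : x y / x * y} ->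
  {morph tmap f g : s t / s * t}.
Proof.
move=> fL gL fM gM; apply: tlift_morph => [|x x' y y'].
  exact: (bilin_comp (tens_bilin _ _)).
by rewrite fM gM tensM.
Qed.

Lemma tassoc_morph A B D : {morph @tassoc K A B D : s t / s * t}.
Proof.
have [tL tR] := tens_bilin B D; have [sL sR] := tens_bilin A (tensor B D).
pose phi (w : D) := fun (u : A) (v : B) => u ⊗ (v ⊗ w).
have phiB w : bilin (phi w).
  by split=> [y|x] a r s; rewrite /phi ?tL ?sL ?sR.
apply: tlift_morph => [|x x' y y'].
  by apply: tlift_bilin => x y a r s /=; rewrite tR sR.
apply: (tens_ext (f := fun x => tlift (phi (y * y')) (x * x'))
   (g := fun x => tlift (phi y) x * tlift (phi y') x')) => {x} [a u v|a u v|u v].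
- by rewrite mulrDl -scalerAl tlift_linear.
- by rewrite tlift_linear mulrDl -scalerAl.
apply: (tens_ext (f := fun x' => tlift (phi (y * y')) ((u ⊗ v) * x'))
   (g := fun x' => tlift (phi y) (u ⊗ v) * tlift (phi y') x'))
   => {x'} [a r s|a r s|u' v'].
- by rewrite mulrDr -scalerAr tlift_linear.
- by rewrite tlift_linear mulrDr -scalerAr.
by rewrite tensM !tliftE // /phi !tensM.
Qed.
End TensorMorphisms.

Section Orth.
Variables (K : fieldType) (B : falgType K) (I : finType) (E : I -> B).
Hypothesis EM : forall i j, E i * E j = if i == j then E i else 0.
Lemma orthM f g :
  (\sum_i f i *: E i) * (\sum_i g i *: E i) = \sum_i (f i * g i) *: E i.
Proof.
rewrite mulr_suml; apply: eq_bigr => i _; rewrite mulr_sumr (bigD1 i) //=.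
rewrite -scalerAl -scalerAr EM eqxx scalerA big1 ?addr0 // => j /negbTE ji.
by rewrite -scalerAl -scalerAr EM eq_sym ji !scaler0.
Qed.
End Orth.

Section Twist.
Variables (K : fieldType) (H : falgType K) (h : hopf_algebra H).
Variables (A : finGroupType) (e : A -> H).

(* J and U_J for the idempotents e; the section derives the Hopf algebra axioms
   from the identities satisfied by the idempotents of a finite abelian
   subgroup, which are checked afterwards. *)
Definition twist_elt (w : A -> A -> K) : tensor H H :=
  \sum_a \sum_b w a b *: (e a ⊗ e b).
Definition twist_unit (w : A -> A -> K) : H := \sum_a w a a^-1%g *: e a.

Definition twisted_comul w (x : H) : tensor H H :=
  twist_elt w * comul h x * (twist_elt w)^-1.
Definition twisted_antipode w (x : H) : H :=
  twist_unit w * antipode h x * (twist_unit w)^-1.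

Hypothesis eM : forall a b, e a * e b = if a == b then e a else 0.
Hypothesis esum : \sum_a e a = 1.
Hypothesis eD : forall a, comul h (e a) = \sum_b e b ⊗ e (b^-1 * a)%g.
Hypothesis eS : forall a, antipode h (e a) = e a^-1%g.
Hypothesis eC : forall a, counit h (e a) = (a == 1%g)%:R.
Hypothesis SM : forall x y, antipode h (x * y) = antipode h y * antipode h x.

Let E2 (i : A * A) : tensor H H := e i.1 ⊗ e i.2.
Let E3 (i : A * A * A) : tensor H (tensor H H) :=
  e i.1.1 ⊗ (e i.1.2 ⊗ e i.2).

Let tens0l (U V : vectType K) (v : V) : (0 : U) ⊗ v = 0.
Proof. exact: (lin0 ((tens_bilin U V).1 v)). Qed.
Let tens0r (U V : vectType K) (u : U) : u ⊗ (0 : V) = 0.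
Proof. exact: (lin0 ((tens_bilin U V).2 u)). Qed.
Let tensZl (U V : vectType K) (u : U) (v : V) a : (a *: u) ⊗ v = a *: (u ⊗ v).
Proof. exact: (linZ ((tens_bilin U V).1 v)). Qed.
Let tensZr (U V : vectType K) (u : U) (v : V) a : u ⊗ (a *: v) = a *: (u ⊗ v).
Proof. exact: (linZ ((tens_bilin U V).2 u)). Qed.
Let tens_suml (U V : vectType K) (v : V) I (r : seq I) (P : pred I) (F : I -> U) :
  (\sum_(i <- r | P i) F i) ⊗ v = \sum_(i <- r | P i) (F i ⊗ v).
Proof. exact: (lin_sum ((tens_bilin U V).1 v)). Qed.
Let tens_sumr (U V : vectType K) (u : U) I (r : seq I) (P : pred I) (F : I -> V) :
  u ⊗ (\sum_(i <- r | P i) F i) = \sum_(i <- r | P i) (u ⊗ F i).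
Proof. exact: (lin_sum ((tens_bilin U V).2 u)). Qed.

Let E2M i j : E2 i * E2 j = if i == j then E2 i else 0.
Proof.
case: i j => [a b] [a' b']; rewrite /E2 tensM !eM xpair_eqE /=.
by do 2![case: eqP => _]; rewrite ?tens0l ?tens0r.
Qed.
Let E3M i j : E3 i * E3 j = if i == j then E3 i else 0.
Proof.
case: i j => [[a b] c] [[a' b'] c']; rewrite /E3 !tensM !eM !xpair_eqE /=.
by do 3![case: eqP => _]; rewrite ?(tens0l, tens0r).
Qed.

Let twistE w : twist_elt w = \sum_i w i.1 i.2 *: E2 i.
Proof. exact: pair_bigA. Qed.

Let twistM w w' : twist_elt w * twist_elt w' = twist_elt (fun a b => w a b * w' a b).
Proof. by rewrite !twistE orthM. Qed.

Let twist1 : twist_elt (fun _ _ => 1) = 1.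
Proof.
transitivity ((\sum_a e a) ⊗ (\sum_b e b)); last by rewrite esum.
rewrite tens_suml; apply: eq_bigr => a _.
by rewrite tens_sumr; apply: eq_bigr => b _; rewrite scale1r.
Qed.

Let unitM w w' : twist_unit w * twist_unit w' = twist_unit (fun a b => w a b * w' a b).
Proof. exact: orthM. Qed.
Let unit1 : twist_unit (fun _ _ => 1) = 1.
Proof. by rewrite -esum; apply: eq_bigr => a _; rewrite scale1r. Qed.

Variable w : A -> A -> K.
Hypothesis wP : normalized_2cocycle w.

Let v a b := (w a b)^-1.
Let w0 a b : w a b != 0. Proof. by case: wP. Qed.
Let w1r a : w a 1%g = 1. Proof. by case: wP. Qed.
Let w1l a : w 1%g a = 1. Proof. by case: wP. Qed.
Let wC a b c : w a b * w (a * b)%g c = w b c * w a (b * c)%g.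
Proof. by case: wP. Qed.

Lemma twist_elt_eq f g : f =2 g -> twist_elt f = twist_elt g.
Proof. by move=> fg; do 2![apply: eq_bigr => ? _]; rewrite fg. Qed.
Lemma twist_unit_eq f g : f =2 g -> twist_unit f = twist_unit g.
Proof. by move=> fg; apply: eq_bigr => ? _; rewrite fg. Qed.

Let twv : twist_elt w * twist_elt v = 1.
Proof. by rewrite twistM -twist1; apply: twist_elt_eq => a b; rewrite /v divff. Qed.
Let tvw : twist_elt v * twist_elt w = 1.
Proof. by rewrite twistM -twist1; apply: twist_elt_eq => a b; rewrite /v mulVf. Qed.
Let uwv : twist_unit w * twist_unit v = 1.
Proof. by rewrite unitM -unit1; apply: twist_unit_eq => a b; rewrite /v divff. Qed.
Let uvw : twist_unit v * twist_unit w = 1.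
Proof. by rewrite unitM -unit1; apply: twist_unit_eq => a b; rewrite /v mulVf. Qed.

Lemma twist_elt_unit : twist_elt w \is a GRing.unit.
Proof. by apply/unitrP; exists (twist_elt v). Qed.
Let twist_eltV : (twist_elt w)^-1 = twist_elt v.
Proof. by rewrite -[RHS]mul1r -(mulVr twist_elt_unit) -mulrA twv mulr1. Qed.
Lemma twist_unit_unit : twist_unit w \is a GRing.unit.
Proof. by apply/unitrP; exists (twist_unit v). Qed.
Let twist_unitV : (twist_unit w)^-1 = twist_unit v.
Proof. by rewrite -[RHS]mul1r -(mulVr twist_unit_unit) -mulrA uwv mulr1. Qed.

Let dL := comul_linear h.
Let dM : {morph comul h : x y / x * y}. Proof. exact: (comul_morph h).2. Qed.
Let d1 : comul h 1 = 1. Proof. exact: (comul_morph h).1. Qed.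
Let sL := antipode_linear h.

Lemma twisted_comul_linear : linear (twisted_comul w).
Proof.
move=> a x y; rewrite /twisted_comul dL mulrDr mulrDl.
by rewrite -scalerAr -scalerAl.
Qed.

Lemma twisted_comul_morph : monoid_morphism (twisted_comul w).
Proof.
split=> [|x y]; rewrite /twisted_comul.
  by rewrite d1 mulr1 divrr ?twist_elt_unit.
by rewrite dM !mulrA divrK ?twist_elt_unit // .
Qed.

Lemma twisted_antipode_linear : linear (twisted_antipode w).
Proof.
move=> a x y; rewrite /twisted_antipode sL mulrDr mulrDl.
by rewrite -scalerAr -scalerAl.
Qed.

Let sum3 (V : nmodType) (F : A * A * A -> V) :
  \sum_i F i = \sum_a \sum_b \sum_c F (a, b, c).
Proof.
transitivity (\sum_(ab : A * A) \sum_c F (ab, c)).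
  rewrite (pair_bigA _ (fun ab c => F (ab, c))) /=.
  by apply: eq_bigr => -[].
rewrite (pair_bigA _ (fun a b => \sum_c F (a, b, c))) /=.
by apply: eq_bigr => -[].
Qed.

Let L1 f : tassoc (twist_elt f ⊗ 1) = \sum_i f i.1.1 i.1.2 *: E3 i.
Proof.
rewrite sum3 /twist_elt tens_suml (lin_sum (@tassoc_linear _ _ _ _)).
apply: eq_bigr => a _; rewrite tens_suml (lin_sum (@tassoc_linear _ _ _ _)).
apply: eq_bigr => b _; rewrite tensZl (linZ (@tassoc_linear _ _ _ _)) tassocE.
by rewrite -[X in _ ⊗ (_ ⊗ X)]esum !tens_sumr scaler_sumr.
Qed.

Let L2 f : tassoc (tmap (comul h) id (twist_elt f)) =
  \sum_i f (i.1.1 * i.1.2)%g i.2 *: E3 i.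
Proof.
have aL := @tassoc_linear K H H H; have mL := tmap_linear (comul h) (@id H).
pose F x c a := f x c *: (e a ⊗ (e (a^-1 * x)%g ⊗ e c)).
transitivity (\sum_x \sum_c \sum_a F x c a).
  rewrite /twist_elt (lin_sum mL) (lin_sum aL); apply: eq_bigr => x _.
  rewrite (lin_sum mL) (lin_sum aL); apply: eq_bigr => c _.
  rewrite (linZ mL) (linZ aL) tmapE // eD tens_suml (lin_sum aL) scaler_sumr.
  by apply: eq_bigr => a _; rewrite tassocE.
rewrite sum3; under eq_bigr => x _ do rewrite exchange_big /=.
rewrite exchange_big; apply: eq_bigr => a _ /=.
rewrite (reindex_inj (mulgI a)); apply: eq_bigr => b _; apply: eq_bigr => c _.
by rewrite /F mulKg.
Qed.

Let R1 f : 1 ⊗ twist_elt f = \sum_i f i.1.2 i.2 *: E3 i.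
Proof.
rewrite sum3 -esum tens_suml; apply: eq_bigr => a _.
rewrite /twist_elt tens_sumr; apply: eq_bigr => b _; rewrite tens_sumr.
by apply: eq_bigr => c _; rewrite tensZr.
Qed.

Let R2 f : tmap id (comul h) (twist_elt f) =
  \sum_i f i.1.1 (i.1.2 * i.2)%g *: E3 i.
Proof.
have mL := tmap_linear (@id H) (comul h).
rewrite sum3 /twist_elt (lin_sum mL); apply: eq_bigr => a _.
rewrite (lin_sum mL).
under eq_bigr => x _ do rewrite (linZ mL) tmapE // eD tens_sumr scaler_sumr.
rewrite exchange_big /=; apply: eq_bigr => b _.
by rewrite (reindex_inj (mulgI b)); apply: eq_bigr => c _; rewrite mulKg.
Qed.

Lemma twisted_coassoc x :
  tassoc (tmap (twisted_comul w) id (twisted_comul w x)) =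
  tmap id (twisted_comul w) (twisted_comul w x).
Proof.
set T := twist_elt w; set V := twist_elt v; have tL := twisted_comul_linear.
have lE t : tmap (twisted_comul w) id t =
    (T ⊗ 1) * tmap (comul h) id t * (V ⊗ 1).
  move: t; apply: tens_ext => [|a s t|u u']; first exact: tmap_linear.
    by rewrite tmap_linear mulrDr mulrDl -scalerAr -scalerAl.
  by rewrite !tmapE // !tensM mul1r mulr1 /twisted_comul twist_eltV.
have rE t : tmap id (twisted_comul w) t =
    (1 ⊗ T) * tmap id (comul h) t * (1 ⊗ V).
  move: t; apply: tens_ext => [|a s t|u u']; first exact: tmap_linear.
    by rewrite tmap_linear mulrDr mulrDl -scalerAr -scalerAl.
  by rewrite !tmapE // !tensM mul1r mulr1 /twisted_comul twist_eltV.
have lM : {morph tmap (comul h) (@id H) : s t / s * t}.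
  by apply: tmap_morph.
have rM : {morph tmap (@id H) (comul h) : s t / s * t}.
  by apply: tmap_morph.
rewrite lE rE [in LHS]/twisted_comul [in RHS]/twisted_comul twist_eltV !lM !rM.
rewrite !tassoc_morph coassociative !L1 !L2 !R1 !R2.
rewrite !mulrA -!(mulrA _ (\sum_i v _ _ *: _)) !(orthM E3M).
congr (_ * _ * _); apply: eq_bigr => -[[a b] c] _ /=.
  by rewrite wC.
by congr (_ *: _); rewrite /v -!invfM [w (a * b)%g c * _]mulrC wC mulrC.
Qed.

Let sum_only (V : lmodType K) (F : A -> V) a (f : A -> K) :
  (forall b, b != a -> f b = 0) -> \sum_b f b *: F b = f a *: F a.
Proof.
move=> f0; rewrite (bigD1 a) //= big1 ?addr0 // => b ba.
by rewrite f0 // scale0r.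
Qed.

Lemma twisted_counital_l x :
  tlift (fun y z => counit h y *: z) (twisted_comul w x) = x.
Proof.
have cL := counit_linear h; set P := tlift _.
have PB : bilin (fun y z : H => counit h y *: z).
  split=> [z|y] a r s; first by rewrite cL scalerDl scalerA.
  by rewrite scalerDr !scalerA mulrC.
have PL : linear P := @tlift_linear _ _ _ _ _.
have PM : {morph P : s t / s * t}.
  apply: tlift_morph => // y y' z z'.
  by rewrite (counit_morph h).2 -scalerAl -scalerAr scalerA.
have PT f : (forall b, f 1%g b = 1) -> P (twist_elt f) = 1.
  move=> f1; rewrite /twist_elt (lin_sum PL) -esum.
  rewrite (bigD1 1%g) //= [X in _ + X]big1 ?addr0 => [|a /negbTE a1].
    rewrite (lin_sum PL); apply: eq_bigr => b _.
    by rewrite (linZ PL) /P tliftE // eC eqxx f1 !scale1r.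
  rewrite (lin_sum PL); apply: big1 => b _.
  by rewrite (linZ PL) /P tliftE // eC a1 scale0r scaler0.
rewrite /twisted_comul twist_eltV !PM !PT ?mul1r ?mulr1 => [|b|b] //.
  exact: counital_l.
by rewrite /v w1l invr1.
Qed.

Lemma twisted_counital_r x :
  tlift (fun y z => counit h z *: y) (twisted_comul w x) = x.
Proof.
have cL := counit_linear h; set P := tlift _.
have PB : bilin (fun y z : H => counit h z *: y).
  split=> [z|y] a r s; last by rewrite cL scalerDl scalerA.
  by rewrite scalerDr !scalerA mulrC.
have PL : linear P := @tlift_linear _ _ _ _ _.
have PM : {morph P : s t / s * t}.
  apply: tlift_morph => // y y' z z'.
  by rewrite (counit_morph h).2 -scalerAl -scalerAr scalerA.
have PT f : (forall b, f b 1%g = 1) -> P (twist_elt f) = 1.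
  move=> f1; rewrite /twist_elt exchange_big (lin_sum PL) -esum.
  rewrite (bigD1 1%g) //= [X in _ + X]big1 ?addr0 => [|a /negbTE a1].
    rewrite (lin_sum PL); apply: eq_bigr => b _.
    by rewrite (linZ PL) /P tliftE // eC eqxx f1 !scale1r.
  rewrite (lin_sum PL); apply: big1 => b _.
  by rewrite (linZ PL) /P tliftE // eC a1 scale0r scaler0.
rewrite /twisted_comul twist_eltV !PM !PT ?mul1r ?mulr1 => [|b|b] //.
  exact: counital_r.
by rewrite /v w1r invr1.
Qed.

Let wVl a : w a^-1%g a = w a a^-1%g.
Proof. by have := wC a a^-1%g a; rewrite mulgV mulVg w1l w1r !mulr1. Qed.

Let eUv a : e a * twist_unit v = v a a^-1%g *: e a.
Proof.
rewrite mulr_sumr (bigD1 a) //= -scalerAr eM eqxx big1 ?addr0 // => b /negbTE ba.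
by rewrite -scalerAr eM eq_sym ba scaler0.
Qed.
Let eUw a : e a * twist_unit w = w a a^-1%g *: e a.
Proof.
rewrite mulr_sumr (bigD1 a) //= -scalerAr eM eqxx big1 ?addr0 // => b /negbTE ba.
by rewrite -scalerAr eM eq_sym ba scaler0.
Qed.

Let sumVl f : \sum_a \sum_b f a b *: (e a^-1%g * e b) = \sum_b f b^-1%g b *: e b.
Proof.
rewrite exchange_big; apply: eq_bigr => b _ /=.
rewrite (bigD1 b^-1%g) //= invgK eM eqxx big1 ?addr0 // => a ne.
by rewrite eM (can2_eq invgK invgK) (negbTE ne) scaler0.
Qed.
Let sumVr f : \sum_a \sum_b f a b *: (e a * e b^-1%g) = \sum_a f a a^-1%g *: e a.
Proof.
apply: eq_bigr => a _; rewrite (bigD1 a^-1%g) //= invgK eM eqxx big1 ?addr0 //.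
move=> b ne; rewrite eM eq_sym (can2_eq invgK invgK) (negbTE ne) scaler0 //.
Qed.

Let mul3B (V : H) (f g : H -> H) : linear f -> linear g ->
  bilin (fun x y : H => f x * V * g y).
Proof.
move=> fL gL; split=> [y|x] a r s.
  by rewrite fL !mulrDl -!scalerAl.
by rewrite gL mulrDr -scalerAr.
Qed.

Let fl V (x y : H) := antipode h x * V * y.
Let fr V (x y : H) := x * V * antipode h y.
Let flB V : bilin (fl V). Proof. exact: mul3B. Qed.
Let frB V : bilin (fr V). Proof. exact: mul3B. Qed.

Let fl_left V f s : tlift (fl V) (twist_elt f * s) =
  tlift (fl (\sum_a \sum_b f a b *: (e a^-1%g * V * e b))) s.
Proof.
have lL U := @tlift_linear K H H H (fl U).
move: s; apply: tens_ext => [a x y||x y]; last 1 first.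
- rewrite [RHS]tliftE // /fl mulr_sumr !mulr_suml (lin_sum (lL _)).
  apply: eq_bigr => a _; rewrite mulr_sumr !mulr_suml (lin_sum (lL _)).
  apply: eq_bigr => b _; rewrite -scalerAl (linZ (lL _)) tensM tliftE //.
  by rewrite /fl SM eS -scalerAr -scalerAl !mulrA.
- by rewrite mulrDr -scalerAr lL.
- exact: lL.
Qed.

Let fl_right V f s : tlift (fl V) (s * twist_elt f) =
  \sum_a \sum_b f a b *: (e a^-1%g * tlift (fl V) s * e b).
Proof.
have lL := @tlift_linear K H H H (fl V).
move: s; apply: tens_ext => [c x y|c x y|x y].
- by rewrite mulrDl -scalerAl lL.
- rewrite scaler_sumr -big_split; apply: eq_bigr => a _ /=.
  rewrite scaler_sumr -big_split; apply: eq_bigr => b _ /=.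
  rewrite lL mulrDr mulrDl -scalerAr -scalerAl scalerDr !scalerA.
  by rewrite mulrC.
rewrite mulr_sumr (lin_sum lL) tliftE //; apply: eq_bigr => a _.
rewrite mulr_sumr (lin_sum lL); apply: eq_bigr => b _.
by rewrite -scalerAr (linZ lL) tensM tliftE // /fl SM eS !mulrA.
Qed.

Let fr_right V f s : tlift (fr V) (s * twist_elt f) =
  tlift (fr (\sum_a \sum_b f a b *: (e a * V * e b^-1%g))) s.
Proof.
have lL U := @tlift_linear K H H H (fr U).
move: s; apply: tens_ext => [a x y||x y]; last 1 first.
- rewrite [RHS]tliftE // /fr !mulr_sumr !mulr_suml (lin_sum (lL _)).
  apply: eq_bigr => a _; rewrite !mulr_sumr !mulr_suml (lin_sum (lL _)).
  apply: eq_bigr => b _; rewrite -scalerAr (linZ (lL _)) tensM tliftE //.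
  by rewrite /fr SM eS -scalerAr -scalerAl !mulrA.
- by rewrite mulrDl -scalerAl lL.
- exact: lL.
Qed.

Let fr_left V f s : tlift (fr V) (twist_elt f * s) =
  \sum_a \sum_b f a b *: (e a * tlift (fr V) s * e b^-1%g).
Proof.
have lL := @tlift_linear K H H H (fr V).
move: s; apply: tens_ext => [c x y|c x y|x y].
- by rewrite mulrDr -scalerAr lL.
- rewrite scaler_sumr -big_split; apply: eq_bigr => a _ /=.
  rewrite scaler_sumr -big_split; apply: eq_bigr => b _ /=.
  rewrite lL mulrDr mulrDl -scalerAr -scalerAl scalerDr !scalerA.
  by rewrite mulrC.
rewrite mulr_suml (lin_sum lL) tliftE //; apply: eq_bigr => a _.
rewrite mulr_suml (lin_sum lL); apply: eq_bigr => b _.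
by rewrite -scalerAl (linZ lL) tensM tliftE // /fr SM eS !mulrA.
Qed.

Lemma twisted_antipode_l x :
  tlift (fun y z => twisted_antipode w y * z) (twisted_comul w x) =
  (counit h x)%:A.
Proof.
have -> t : tlift (fun y z => twisted_antipode w y * z) t =
    twist_unit w * tlift (fl (twist_unit v)) t.
  move: t; apply: tens_ext => [||y z]; first exact: tlift_linear.
    by move=> a s t; rewrite tlift_linear mulrDr -scalerAr.
  rewrite (tliftE _ _ (bilin_comp (mul_bilin H) twisted_antipode_linear (@id_linear K H))).
  by rewrite tliftE // /twisted_antipode twist_unitV /fl !mulrA.
rewrite /twisted_comul twist_eltV -mulrA fl_left.
have -> : \sum_a \sum_b w a b *: (e a^-1%g * twist_unit v * e b) = 1.
  rewrite -esum -(eq_bigr _ (fun b _ => scale1r (e b))).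
  transitivity (\sum_a \sum_b (w a b * v a^-1%g a) *: (e a^-1%g * e b)).
    apply: eq_bigr => a _; apply: eq_bigr => b _.
    by rewrite eUv invgK -scalerAl scalerA.
  rewrite sumVl; apply: eq_bigr => b _.
  by rewrite invgK /v wVl divff.
rewrite fl_right.
have -> : tlift (fl 1) (comul h x) = (counit h x)%:A.
  rewrite -antipode_l; apply: tlift_ext => y z; by rewrite /fl mulr1.
transitivity (twist_unit w * (counit h x *: (\sum_a \sum_b v a b *: (e a^-1%g * e b)))).
  congr (_ * _); rewrite scaler_sumr; apply: eq_bigr => a _.
  rewrite scaler_sumr; apply: eq_bigr => b _.
  by rewrite -scalerAr mulr1 -scalerAl !scalerA mulrC.
rewrite sumVl -scalerAr; congr (_ *: _).
by rewrite -[RHS]uwv; congr (_ * _); apply: eq_bigr => b _; rewrite /v wVl.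
Qed.

Lemma twisted_antipode_r x :
  tlift (fun y z => y * twisted_antipode w z) (twisted_comul w x) =
  (counit h x)%:A.
Proof.
have -> t : tlift (fun y z => y * twisted_antipode w z) t =
    tlift (fr (twist_unit w)) t * twist_unit v.
  move: t; apply: tens_ext => [||y z]; first exact: tlift_linear.
    by move=> a s t; rewrite tlift_linear mulrDl -scalerAl.
  rewrite (tliftE _ _ (bilin_comp (mul_bilin H) (@id_linear K H) twisted_antipode_linear)).
  by rewrite tliftE // /twisted_antipode twist_unitV /fr !mulrA.
rewrite /twisted_comul twist_eltV fr_right.
have -> : \sum_a \sum_b v a b *: (e a * twist_unit w * e b^-1%g) = 1.
  rewrite -esum -(eq_bigr _ (fun b _ => scale1r (e b))).
  transitivity (\sum_a \sum_b (v a b * w a a^-1%g) *: (e a * e b^-1%g)).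
    apply: eq_bigr => a _; apply: eq_bigr => b _.
    by rewrite eUw -scalerAl scalerA.
  by rewrite sumVr; apply: eq_bigr => b _; rewrite /v mulVf.
rewrite fr_left.
have -> : tlift (fr 1) (comul h x) = (counit h x)%:A.
  rewrite -antipode_r; apply: tlift_ext => y z; by rewrite /fr mulr1.
transitivity ((counit h x *: (\sum_a \sum_b w a b *: (e a * e b^-1%g))) * twist_unit v).
  congr (_ * _); rewrite scaler_sumr; apply: eq_bigr => a _.
  rewrite scaler_sumr; apply: eq_bigr => b _.
  by rewrite -scalerAr mulr1 -scalerAl !scalerA mulrC.
by rewrite sumVr -scalerAl; congr (_ *: _); rewrite -[RHS]uwv.
Qed.

End Twist.

Section GroupTwist.
Variables (C : numClosedFieldType) (gT : finGroupType) (M : {group gT}).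

Definition idem (phi : dual C (subg_of M)) : group_alg C gT :=
  (#|M|%:R)^-1 *: \sum_(m : subg_of M) phi m^-1%g *: gelt C (sgval m).

Hypothesis abM : abelian M.

Let N0 : #|M|%:R != 0 :> C.
Proof. by rewrite pnatr_eq0 -lt0n cardG_gt0. Qed.
Let cMM (x y : subg_of M) : (x * y = y * x)%g.
Proof. by apply: subg_inj; rewrite /= (centsP abM) ?subgP. Qed.
Let cardM : #|subg_of M| = #|M|.
Proof. by rewrite card_sub; apply: eq_card. Qed.
Let sgM (x y : subg_of M) : sgval (x * y)%g = (sgval x * sgval y)%g.
Proof. by []. Qed.
Let sgV (x : subg_of M) : sgval x^-1%g = (sgval x)^-1%g.
Proof. by []. Qed.

Let gelt_idem m phi : gelt C (sgval m) * idem phi = phi m *: idem phi.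
Proof.
rewrite /idem -scalerAr scalerA mulrC -scalerA; congr (_ *: _).
rewrite mulr_sumr scaler_sumr [RHS](reindex_inj (mulgI m)) /=.
apply: eq_bigr => n _; rewrite -scalerAr geltM -sgM scalerA -dualM.
suff -> : (m * (m * n)^-1 = n^-1)%g by [].
by rewrite invMg cMM mulgKV.
Qed.

Lemma idemM phi psi : idem phi * idem psi = if phi == psi then idem phi else 0.
Proof.
rewrite {1}/idem -scalerAl mulr_suml.
under eq_bigr => m _ do rewrite -scalerAl gelt_idem scalerA.
rewrite -scaler_suml scalerA.
have -> : \sum_(m : subg_of M) phi m^-1%g * psi m = #|M|%:R * (phi == psi)%:R.
  have := dual_sumG (phi^-1 * psi)%g; rewrite cardM natrM -eq_mulVg1 => <-.
  by apply: eq_bigr => m _; rewrite dualME dualVE.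
by rewrite mulKf //; case: eqP => [->|_]; rewrite ?scale1r ?scale0r.
Qed.

Lemma idem_sum : \sum_phi idem phi = 1.
Proof.
rewrite /idem -scaler_sumr exchange_big /=.
under eq_bigr => m _ do rewrite -scaler_suml dual_sum // cardM.
rewrite (bigD1 1%g) //= invg1 eqxx muln1 scalerDr scalerA mulVf // scale1r.
by rewrite big1 ?scaler0 ?addr0 // => m /negbTE m1; rewrite invg_eq1 m1 muln0 scale0r.
Qed.

Let geltE m : gelt C (sgval m) = \sum_(phi : dual C (subg_of M)) phi m *: idem phi.
Proof.
by rewrite -[LHS]mulr1 -idem_sum mulr_sumr; apply: eq_bigr => phi _.
Qed.

Lemma idem_comul phi :
  comul (group_hopf C gT) (idem phi) = \sum_psi idem psi ⊗ idem (psi^-1 * phi)%g.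
Proof.
have cL := @galg_comul_linear C gT; have tB := tens_bilin (group_alg C gT) (group_alg C gT).
rewrite /= {1}/idem (linZ cL) (lin_sum cL).
transitivity ((#|M|%:R)^-1 *: \sum_(m : subg_of M) \sum_(psi : dual C (subg_of M))
   (phi m^-1%g * psi m) *: (idem psi ⊗ gelt C (sgval m))).
  congr (_ *: _); apply: eq_bigr => m _; rewrite (linZ cL) galg_comulE.
  rewrite {1}geltE (lin_sum (tB.1 _)) scaler_sumr; apply: eq_bigr => psi _.
  by rewrite (linZ (tB.1 _)) scalerA.
rewrite exchange_big scaler_sumr; apply: eq_bigr => psi _.
rewrite [in RHS]/idem (linZ (tB.2 _)) (lin_sum (tB.2 _)); congr (_ *: _).
apply: eq_bigr => m _; rewrite (linZ (tB.2 _)) dualME dualVE invgK.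
by rewrite mulrC.
Qed.

Lemma idem_antipode phi : antipode (group_hopf C gT) (idem phi) = idem phi^-1%g.
Proof.
have sL := @galg_antipode_linear C gT.
rewrite /= {1}/idem (linZ sL) (lin_sum sL); congr (_ *: _).
rewrite (reindex_inj invg_inj); apply: eq_bigr => m _ /=.
by rewrite (linZ sL) galg_antipodeE dualVE ?sgV !invgK.
Qed.

Lemma idem_counit phi : counit (group_hopf C gT) (idem phi) = (phi == 1%g)%:R.
Proof.
have cL : linear (@galg_counit C gT : _ -> C^o) := @galg_counit_linear C gT.
rewrite /= {1}/idem (linZ cL) (lin_sum cL).
transitivity ((#|M|%:R)^-1 * \sum_(m : subg_of M) phi m^-1%g).
  by congr (_ * _); apply: eq_bigr => m _; rewrite (linZ cL) galg_counitE; apply: mulr1.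
rewrite (reindex_inj invg_inj) /=; under eq_bigr => m _ do rewrite invgK.
by rewrite dual_sumG cardM natrM mulKf.
Qed.

Lemma galg_antipodeM x y : antipode (group_hopf C gT) (x * y) =
  antipode (group_hopf C gT) y * antipode (group_hopf C gT) x.
Proof.
have sL := @galg_antipode_linear C gT.
move: x y; apply: (galg_ext2) => [y|x|y|x|a b] /=.
- by move=> a u v; rewrite mulrDl -scalerAl sL.
- by move=> a u v; rewrite mulrDr -scalerAr sL.
- by move=> a u v; rewrite sL mulrDr -scalerAr.
- by move=> a u v; rewrite sL mulrDl -scalerAl.
by rewrite geltM !galg_antipodeE geltM invMg.
Qed.

Variable omega : dual C (subg_of M) -> dual C (subg_of M) -> C.
Hypothesis cocycle : normalized_2cocycle omega.

Definition twisted_group_hopf : hopf_algebra (group_alg C gT) :=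
  let H := group_hopf C gT in
  @HopfAlgebra C (group_alg C gT)
    (twisted_comul H idem omega) (counit H) (twisted_antipode H idem omega)
    (twisted_comul_linear _ _ _)
    (twisted_comul_morph H idemM idem_sum cocycle)
    (counit_linear H) (counit_morph H)
    (twisted_antipode_linear _ _ _)
    (twisted_coassoc idemM idem_sum idem_comul cocycle)
    (twisted_counital_l idemM idem_sum idem_counit cocycle)
    (twisted_counital_r idemM idem_sum idem_counit cocycle)
    (twisted_antipode_l idemM idem_sum idem_antipode galg_antipodeM cocycle)
    (twisted_antipode_r idemM idem_sum idem_antipode galg_antipodeM cocycle).

End GroupTwist.

Section HopfOrder.
Variables (K : fieldType) (R : subringClosed K).

Record subring_of := SubringOf {
  subring_val : K; subring_valP : subring_val \in R }.
HB.instance Definition _ := [isSub for subring_val].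
HB.instance Definition _ := [Choice of subring_of by <:].
HB.instance Definition _ := [SubChoice_isSubComNzRing of subring_of by <:].

(* In what follows X is a subset of the K-space V, meant to be an
   R-submodule. *)
Section Submodule.
Variables (V : vectType K) (X : set V).

Definition is_submodule : Prop :=
  [/\ X 0, forall x y, X x -> X y -> X (x + y)
    & forall a x, a \in R -> X x -> X (a *: x)].

Definition finitely_generated : Prop :=
  exists n (x : 'I_n -> V), (forall i, X (x i)) /\
    forall y, X y -> exists2 a : 'I_n -> K,
      forall i, a i \in R & y = \sum_i a i *: x i.

(* R-linearity on X of a map that is only relevant on X. *)
Definition linear_on (N : lmodType subring_of) (f : V -> N) : Prop :=
  forall (a : subring_of) x y, X x -> X y ->
    f (subring_val a *: x + y) = a *: f x + f y.

Definition projective : Prop :=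
  forall (M N : lmodType subring_of) (g : {linear M -> N}) (f : V -> N),
    (forall n, exists m, g m = n) -> linear_on f ->
  exists2 f' : V -> M, linear_on f' & forall x, X x -> g (f' x) = f x.

Definition balanced (Z : zmodType) (b : V -> K -> Z) : Prop :=
  [/\ forall x y k, X x -> X y -> b (x + y) k = b x k + b y k,
      forall x k l, X x -> b x (k + l) = b x k + b x l
    & forall a x k, a \in R -> X x -> b (a *: x) k = b x (a * k)].

(* The natural map X ⊗_R K -> V is an isomorphism: together with the balanced
   map (x, k) |-> k *: x, V has the universal property of X ⊗_R K. *)
Definition base_change_iso : Prop :=
  forall (Z : zmodType) (b : V -> K -> Z), balanced b ->
  exists f : {additive V -> Z},
    (forall x k, X x -> f (k *: x) = b x k) /\
    (forall g : {additive V -> Z},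
       (forall x k, X x -> g (k *: x) = b x k) -> g =1 f).

(* The image of X ⊗_R X in V ⊗_K V. *)
Definition tensor_square : set (tensor V V) :=
  [set t | exists n (x y : 'I_n -> V),
     [/\ forall i, X (x i), forall i, X (y i) & t = \sum_i x i ⊗ y i]].

End Submodule.

Record hopf_order (H : falgType K) (h : hopf_algebra H) (X : set H) : Prop := {
  order_submodule : is_submodule X;
  order_fg : finitely_generated X;
  order_projective : projective X;
  order_base_change : base_change_iso X;
  order1 : X 1;
  orderM : forall x y, X x -> X y -> X (x * y);
  order_comul : forall x, X x -> tensor_square X (comul h x);
  order_counit : forall x, X x -> counit h x \in R;
  order_antipode : forall x, X x -> X (antipode h x) }.

End HopfOrder.

Section NumberRing.
Variables (K : fieldType) (L : fieldExtType rat) (sigma : {rmorphism L -> K}).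
(* The ring of integers of the number field sigma(L) contained in K. *)
Definition number_ring : {pred K} := fun z =>
  `[< exists2 x : L, integralOver (intr : int -> L) x & z = sigma x >].

Lemma number_ring_closed : subring_closed number_ring.
Proof.
split=> [|_ _ /asboolP[x xi ->] /asboolP[y yi ->]|_ _ /asboolP[x xi ->] /asboolP[y yi ->]]; apply/asboolP.
- by exists 1; [apply: integral1 | rewrite rmorph1].
- by exists (x - y); [apply: integral_sub | rewrite rmorphB].
- by exists (x * y); [apply: integral_mul | rewrite rmorphM].
Qed.
HB.instance Definition _ := GRing.isSubringClosed.Build K number_ring number_ring_closed.
End NumberRing.

Section PSL.
Variables (n : nat) (F : finFieldType).
(* n is the size of the matrices and is meant to be positive: 'GL_n[F] consists
   of matrices of size n.-1.+1. *)
Definition SL : {set {'GL_n[F]}} := [set g | \det (GLval g) == 1].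
Lemma SL_group_set : group_set SL.
Proof.
apply/group_setP; split=> [|x y]; first by rewrite inE GL_1E det1.
by rewrite !inE GL_MxE det_mulmx => /eqP-> /eqP->; rewrite mulr1.
Qed.
Canonical SL_group := Group SL_group_set.
Definition PSL : finGroupType := subg_of (SL / 'Z(SL))%G.
End PSL.

(* Main.v *)
(* Let X be a Hopf order of the twisted algebra over a number ring. Since X is a
   finitely generated projective module, a trace of matrix coefficients of a
   comodule takes algebraic integer values on the functionals that are integral
   on X, and the character of a module is such a functional. Take M abelian of
   order q^2 with a nondegenerate cocycle, and let e be the idempotent of the
   trivial character of M. For every g in G, c = |M| e g e is the trace of a
   comodule (of dimension q^2), so that (chi * chi(- c))(c) is an algebraic
   integer for every character chi of G. The twist disappears from this number,
   because J (1 ⊗ e) = 1 ⊗ e and chi is a trace: it equals k T / |M|, where k is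
   the sum of the chi(m g) and T the sum of the chi(m g m' g), for m, m' in M.
   If chi is the permutation character on the cosets of a Sylow p-subgroup P,
   then chi(h) = 0 unless h is a p-element, and then chi(h) = |G : P| mod p.
   So there is no Hopf order as soon as p divides |M| but neither the number of
   p-elements in M g nor that of the (m, m') such that m g m' g is a p-element.
   In PSL_(3 + r)(q) take for M the matrices 1 + a E_13 + b E_23 and for g a
   3-cycle: an element of SL is a p-element modulo scalars if and only if its
   characteristic polynomial is a power of some X - b, and both numbers are
   congruent mod p to the order of a subgroup of the multiplicative group of
   F_q. *)
From HB Require Import structures.
Require Import Defs.
From mathcomp Require Import all_boot all_order all_algebra all_fingroup.
From mathcomp Require Import all_solvable all_field.
From mathcomp Require Import boolp classical_sets reals complex.
From mathcomp Require Import ring.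
Set Implicit Arguments.
Unset Strict Implicit.
Unset Printing Implicit Defensive.
Import GRing.Theory Num.Theory.
Local Open Scope ring_scope.

(** * Algebraic integers and traces of matrices *)

Section AlgebraicIntegers.
Variable C : numClosedFieldType.

Definition algint : {pred C} := fun z => `[< integralOver (intr : int -> C) z >].

Lemma algintP z : reflect (integralOver (intr : int -> C) z) (z \in algint).
Proof. exact: asboolP. Qed.

Lemma algint_closed : subring_closed algint.
Proof.
split=> [|x y /algintP xi /algintP yi|x y /algintP xi /algintP yi].
- exact/algintP/integral1.
- exact/algintP/integral_sub.
- exact/algintP/integral_mul.
Qed.
HB.instance Definition _ := GRing.isSubringClosed.Build C algint algint_closed.

(** Integrality is transitive. *)
Lemma algint_root (p : {poly C}) z :
  p \is monic -> p \is a polyOver algint -> root p z -> z \in algint.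
Proof.
move=> p1 /allP pi pz; apply/algintP; apply: (integral_root_monic p1 pz) => c /pi.
by move/algintP.
Qed.

Lemma number_ring_algint (L : fieldExtType rat) (sigma : {rmorphism L -> C}) :
  {subset number_ring sigma <= algint}.
Proof.
move=> _ /asboolP[x xi ->]; apply/algintP.
have [p p1 px] := xi; exists p => //.
rewrite (_ : map_poly _ p = map_poly sigma (map_poly intr p)).
  by rewrite rootE horner_map (eqP px) rmorph0.
by rewrite -map_poly_comp; apply: eq_map_poly => k /=; rewrite rmorph_int.
Qed.

(** The monic equation descends to [rat], since [ratr] is injective, and is then read in [algC],
    where rational algebraic integers are integers. *)
Lemma algint_ratr (a : rat) : (ratr a : C) \in algint -> a \is a Num.int.
Proof.
case/algintP => p p1 pa.
have ra : root (map_poly intr p) a.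
  move: pa; rewrite (_ : map_poly _ p = map_poly ratr (map_poly intr p)).
    by rewrite rootE horner_map fmorph_eq0.
  by rewrite -map_poly_comp; apply: eq_map_poly => k /=; rewrite ratr_int.
have : (ratr a : algC) \in Num.int.
  apply: Cint_rat_Aint; first exact: Crat_rat.
  apply: (@root_monic_Aint (map_poly intr p)).
  - rewrite (_ : map_poly _ p = map_poly ratr (map_poly intr p)).
      by rewrite rootE horner_map (eqP ra) rmorph0.
    by rewrite -map_poly_comp; apply: eq_map_poly => k /=; rewrite ratr_int.
  - exact: monic_map.
  by apply/polyOverP => i; rewrite coef_map /= intr_int.
case/intrP => k /eqP; rewrite -(ratr_int _ k) (inj_eq (fmorph_inj _)) => /eqP ->.
exact: intr_int.
Qed.

Lemma algint_divn (m n : nat) : (0 < n)%N ->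
  (m%:R / n%:R : C) \in algint -> (n %| m)%N.
Proof.
move=> n0; have -> : m%:R / n%:R = ratr (m%:R / n%:R) :> C.
  by rewrite fmorph_div !rmorph_nat.
move/algint_ratr/intrP => [k kE].
have n0' : n%:R != 0 :> rat by rewrite pnatr_eq0 -lt0n.
have : m%:R = k%:~R * n%:R :> rat by rewrite -kE mulfVK.
rewrite -[m%:R]/(m%:Z%:~R) -[n%:R]/(n%:Z%:~R) -intrM => /eqP.
rewrite eqr_int => /eqP mE.
by rewrite -(absz_nat m) mE abszM dvdn_mull.
Qed.

(* A left eigenvector of F with eigenvalue z is mapped by the W j to a family of
   vectors whose coordinates are eigenvectors of A, hence z is a root of the
   characteristic polynomial of A. *)
Lemma algint_mxtrace n m (F : 'M[C]_n) (W : 'I_m -> 'M[C]_n) (A : 'M[C]_m)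
    (c : 'I_m -> C) :
    (forall j k, A j k \in algint) ->
    (forall j, F *m W j = \sum_k A j k *: W k) ->
    \sum_j c j *: W j = 1%:M ->
  \tr F \in algint.
Proof.
move=> Ai FW W1.
have eigF z : root (char_poly F) z -> z \in algint.
  rewrite -eigenvalue_root_char => /eigenvalueP[w wF w0].
  have [[j l] /= wl] : exists jl, (w *m W jl.1) 0 jl.2 != 0.
    apply/existsP; apply: contraNT w0 => /existsPn h; apply/eqP.
    rewrite -[w]mulmx1 -W1 mulmx_sumr big1 // => j _.
    rewrite -scalemxAr (_ : w *m W j = 0) ?scaler0 //; apply/rowP => l.
    by move: (h (j, l)) => /negPn/eqP ->; rewrite mxE.
  apply: (@algint_root (char_poly A^T)); first exact: char_poly_monic.
    rewrite /char_poly /determinant rpred_sum // => s _; rewrite rpredM ?rpredX //.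
      by rewrite rpredN rpred1.
    rewrite rpred_prod // => i _; rewrite !mxE rpredB ?rpredMn ?polyOverX //.
    by rewrite polyOverC.
  rewrite -eigenvalue_root_char; apply/eigenvalueP.
  exists (\row_k (w *m W k) 0 l); last first.
    by apply: contraNneq wl => /rowP/(_ j); rewrite [LHS]mxE [RHS]mxE => ->.
  apply/rowP => i; rewrite !mxE.
  have : (w *m F *m W i) 0 l = (z *: (w *m W i)) 0 l by rewrite wF scalemxAl.
  rewrite -mulmxA FW mulmx_sumr summxE !mxE => <-.
  by apply: eq_bigr => k _; rewrite -scalemxAr !mxE mulrC.
(* The empty matrix has trace 0; otherwise the second coefficient of the characteristic polynomial
   makes the trace the sum of its roots. *)
case: n F W FW W1 eigF => [|n] F W FW W1 eigF; first by rewrite /mxtrace big_ord0 rpred0.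
have [r] := closed_field_poly_normal (char_poly F).
rewrite (monicP (char_poly_monic F)) scale1r => rE.
have szr : size r = n.+1.
  by have := size_char_poly F; rewrite rE size_prod_XsubC => -[].
have := char_poly_trace F (ltn0Sn n).
have -> : n.+1.-1 = (size r).-1 by rewrite szr.
rewrite rE coefPn_prod_XsubC ?szr // => /oppr_inj <-.
rewrite big_seq rpred_sum // => z zr; apply: eigF.
by rewrite rE root_prod_XsubC.
Qed.

(** Version of [algint_mxtrace] for matrices indexed by any finite type, the shape in which
    representations and comodules supply them. *)
Lemma algint_trace (I : finType) m (F : I -> I -> C) (W : 'I_m -> I -> I -> C)
    (A : 'I_m -> 'I_m -> C) (c : 'I_m -> C) :
    (forall j k, A j k \in algint) ->
    (forall j i k, \sum_l F i l * W j l k = \sum_n A j n * W n i k) ->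
    (forall i k, \sum_j c j * W j i k = (i == k)%:R) ->
  \sum_i F i i \in algint.
Proof.
move=> Ai FW W1; pose mx (G : I -> I -> C) : 'M_(#|I|) :=
  \matrix_(i, j) G (enum_val i) (enum_val j).
have <- : \tr (mx F) = \sum_i F i i.
  rewrite [RHS](reindex _ (onW_bij _ (enum_val_bij I))).
  by apply: eq_bigr => i _; rewrite mxE.
apply: (@algint_mxtrace _ m (mx F) (fun j => mx (W j)) (\matrix_(i, j) A i j) c).
- by move=> j k; rewrite mxE.
- move=> j; apply/matrixP => i k; rewrite !mxE summxE.
  rewrite (eq_bigr (fun n => A j n * W n (enum_val i) (enum_val k))); last first.
    by move=> n _; rewrite !mxE.
  rewrite -FW [RHS](reindex _ (onW_bij _ (enum_val_bij I))).
  by apply: eq_bigr => l _; rewrite !mxE.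
apply/matrixP => i k; rewrite summxE mxE -(inj_eq enum_val_inj) -W1.
by apply: eq_bigr => j _; rewrite !mxE.
Qed.

End AlgebraicIntegers.
Arguments algint {C}.

(** * Dual bases of finitely generated projective submodules *)

Section SubmoduleType.
Variables (K : fieldType) (R : subringClosed K) (V : vectType K) (X : set V).
Hypothesis subX : is_submodule R X.

(** The proof of [is_submodule] is an argument so that the instances below, which depend on it, can
    be inferred from the predicate. As [projective] quantifies over module types, [X] has to become
    one. *)
Definition submodule_pred (_ : is_submodule R X) : {pred V} := fun x => `[< X x >].

Lemma submodule_predP x : reflect (X x) (x \in submodule_pred subX).
Proof. exact: asboolP. Qed.

Lemma submodule_zmod_closed : zmod_closed (submodule_pred subX).
Proof.
have [X0 XD XZ] := subX.
split=> [|x y /submodule_predP xX /submodule_predP yX]; apply/submodule_predP => //.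
by rewrite -scaleN1r; apply: XD => //; apply: XZ => //; rewrite rpredN rpred1.
Qed.
HB.instance Definition _ :=
  GRing.isZmodClosed.Build V (submodule_pred subX) submodule_zmod_closed.

Record submodule := Submodule {
  submodule_val : V; _ : submodule_val \in submodule_pred subX }.
HB.instance Definition _ := [isSub for submodule_val].
HB.instance Definition _ := [Choice of submodule by <:].
HB.instance Definition _ := [SubChoice_isSubZmodule of submodule by <:].

Lemma submodule_scale_subproof (a : subring_of R) (x : submodule) :
  subring_val a *: val x \in submodule_pred subX.
Proof.
have [_ _ XZ] := subX; apply/submodule_predP/XZ; first exact: subring_valP.
exact/submodule_predP/(valP x).
Qed.
Definition submodule_scale a x := Submodule (submodule_scale_subproof a x).

Lemma submodule_scaleA a b x :
  submodule_scale a (submodule_scale b x) = submodule_scale (a * b) x.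
Proof. by apply: val_inj; rewrite /= scalerA. Qed.
Lemma submodule_scale1 : left_id 1 submodule_scale.
Proof. by move=> x; apply: val_inj; rewrite /= scale1r. Qed.
Lemma submodule_scaleDr : right_distributive submodule_scale +%R.
Proof. by move=> a x y; apply: val_inj; rewrite /= scalerDr. Qed.
Lemma submodule_scaleDl x : {morph submodule_scale^~ x : a b / a + b}.
Proof. by move=> a b; apply: val_inj; rewrite /= scalerDl. Qed.
HB.instance Definition _ := GRing.Zmodule_isLmodule.Build (subring_of R) submodule
  submodule_scaleA submodule_scale1 submodule_scaleDr submodule_scaleDl.

Section Combination.
Variables (n : nat) (x : 'I_n -> submodule).
Definition lin_comb (a : 'rV[subring_of R]_n) : submodule := \sum_i a 0 i *: x i.
Lemma lin_comb_linear : linear lin_comb.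
Proof.
move=> a u v; rewrite scaler_sumr -big_split; apply: eq_bigr => i _ /=.
by rewrite !mxE scalerDl scalerA.
Qed.
HB.instance Definition _ := GRing.isLinear.Build
  (subring_of R) 'rV[subring_of R]_n submodule *:%R lin_comb lin_comb_linear.
End Combination.

Hypothesis bcX : base_change_iso R X.

Lemma base_change_ext (Z : zmodType) (f g : {additive V -> Z}) :
  (forall x k, X x -> f (k *: x) = g (k *: x)) -> f =1 g.
Proof.
move=> fg; have [X0 XD XZ] := subX.
have [|h [_ hU]] := bcX (b := fun x k => g (k *: x)).
  split=> [x y k _ _|x k l _|a x k _ _].
  - by rewrite scalerDr raddfD.
  - by rewrite scalerDl raddfD.
  - by rewrite scalerA mulrC.
by move=> x; rewrite (hU f) // (hU g).
Qed.

(** The balanced map sending [x] and [k] to [f x * k] factors through [V]; linearity of the factor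
    comes from uniqueness. *)
Lemma linear_on_extend (f : V -> K) :
    (forall x y, X x -> X y -> f (x + y) = f x + f y) ->
    (forall a x, a \in R -> X x -> f (a *: x) = a * f x) ->
  exists2 h : V -> K, scalar h & forall x, X x -> h x = f x.
Proof.
move=> fD fZ; have [|h [hE _]] := bcX (b := fun x k => f x * k).
  split=> [x y k xX yX|x k l _|a x k aR xX]; rewrite ?mulrDr // ?fD ?mulrDl //.
  by rewrite fZ // mulrAC mulrC mulrA.
have hZ a : h \o ( *:%R a) =1 a \*o h.
  apply: (base_change_ext (f := h \o ( *:%R a)) (g := a \*o h)) => x k xX /=.
  by rewrite scalerA !hE // mulrCA.
exists h => [a x y|x xX]; last by rewrite -[x]scale1r hE // mulr1 scale1r.
by rewrite raddfD; congr (_ + _); apply: hZ.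
Qed.

(** Projectivity splits the surjection from a free module given by the generators. The coordinates
    of the splitting extend to linear forms on [V], and the expansion, true on [X], extends by
    uniqueness. *)
Lemma projective_dual_basis :
    finitely_generated R X -> projective R X ->
  exists n (x : 'I_n -> V) (f : 'I_n -> V -> K),
    [/\ forall i, X (x i), forall i, scalar (f i),
        forall i y, X y -> f i y \in R & forall y, y = \sum_i f i y *: x i].
Proof.
case=> n [x [xX xgen]] projX; have [X0 XD XZ] := subX.
pose sx i : submodule := Submodule (introT (submodule_predP _) (xX i)).
have X_val (s : submodule) : X (val s) by apply/submodule_predP/valP.
(* The identity of [X] as a map on all of [V], with default value 0 outside [X]; this is the map to
   be lifted. *)
pose in_sub y : submodule := insubd 0 y.
have in_subK y : X y -> val (in_sub y) = y.
  by move=> yX; apply: insubdK; apply/submodule_predP.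
have comb_onto y : exists a, lin_comb sx a = y.
  have [a aR yE] := xgen _ (X_val y).
  exists (\row_i SubringOf (aR i)); apply: val_inj; rewrite raddf_sum yE.
  by apply: eq_bigr => i _; rewrite mxE.
have in_sub_lin : linear_on X in_sub.
  move=> a y z yX zX; apply: val_inj; rewrite in_subK.
    by rewrite /= !in_subK.
  by apply: XD => //; apply: XZ => //; apply: subring_valP.
have [f' f'L f'E] := projX _ _ (lin_comb sx) in_sub comb_onto in_sub_lin.
have f0 : f' 0 = 0.
  by have := f'L (-1) 0 0 X0 X0; rewrite scaler0 addr0 scaleN1r addNr.
have coord i : exists2 h : V -> K, scalar h &
    forall y, X y -> h y = subring_val (f' y 0 i).
  apply: linear_on_extend => [y z yX zX|a y aR yX].
    by have := f'L 1 y z yX zX; rewrite !scale1r => ->; rewrite mxE.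
  by have := f'L (SubringOf aR) y 0 yX X0; rewrite !addr0 f0 addr0 => ->; rewrite mxE.
have /choice[f fP] i : exists h : V -> K,
    scalar h /\ forall y, X y -> h y = subring_val (f' y 0 i).
  by have [h hL hE] := coord i; exists h.
have fL i : scalar (f i) by have [] := fP i.
have fE i y : X y -> f i y = subring_val (f' y 0 i) by have [_] := fP i; apply.
exists n, x, f; split=> // [i y yX|y].
  by rewrite fE //; apply: subring_valP.
pose g (y : V) := \sum_i f i y *: x i.
have gL : linear g.
  move=> a u v; rewrite scaler_sumr -big_split; apply: eq_bigr => i _ /=.
  by rewrite fL scalerDl scalerA.
pose gA := GRing.isLinear.Build K V V *:%R g gL.
pose gl : {linear V -> V} := HB.pack g gA.
apply: (base_change_ext (f := idfun) (g := gl)) => z k zX /=.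
have -> : g (k *: z) = k *: g z by apply: (linZ gL).
congr (_ *: _); rewrite -[LHS](in_subK _ zX) -f'E // raddf_sum.
by apply: eq_bigr => i _; rewrite fE.
Qed.
End SubmoduleType.

(** * Tensor products of linear forms *)

Section Convolution.
Variables (K : fieldType) (H : falgType K).

Definition tensor_form (f g : H -> K) : tensor H H -> K :=
  @tlift K H H K^o (fun x y => f x * g y).

Lemma tensor_form_linear f g : scalar (tensor_form f g).
Proof. exact: (@tlift_linear K H H K^o). Qed.

Lemma tensor_formE f g x y : scalar f -> scalar g ->
  tensor_form f g (x ⊗ y) = f x * g y.
Proof.
move=> fL gL; rewrite /tensor_form tliftE //; split=> [z|z] a u v /=.
  by rewrite fL mulrDl -mulrA.
by rewrite gL mulrDr mulrCA.
Qed.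

Lemma tensor_form_sum f g I (r : seq I) (P : pred I) (F : I -> tensor H H) :
  tensor_form f g (\sum_(i <- r | P i) F i) =
    \sum_(i <- r | P i) tensor_form f g (F i).
Proof. exact: (@lin_sum K (tensor H H) K^o _ (tensor_form_linear f g)). Qed.

Lemma functional_sum (f : H -> K) (fL : scalar f) I (r : seq I) (P : pred I) (F : I -> H) :
  f (\sum_(i <- r | P i) F i) = \sum_(i <- r | P i) f (F i).
Proof. exact: (@lin_sum K H K^o f fL). Qed.

Lemma functionalZ (f : H -> K) (fL : scalar f) a x : f (a *: x) = a * f x.
Proof. exact: (@linZ K H K^o f fL). Qed.

End Convolution.

(** * Integral forms on a Hopf order *)

Section HopfOrderIntegrality.
Variables (C : numClosedFieldType) (R : subringClosed C).
Variables (H : falgType C) (h : hopf_algebra H) (X : set H).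
Hypothesis R_algint : {subset R <= @algint C}.
Hypothesis ordX : hopf_order R h X.

(** The product of the dual algebra. *)
Definition convol (f g : H -> C) (x : H) : C := tensor_form f g (comul h x).

(** The lattice dual to [X], with all algebraic integers allowed as values, since arguments on
    eigenvalues do not place traces in [R] itself. *)
Definition integral_form (f : H -> C) : Prop :=
  scalar f /\ forall x, X x -> f x \in algint.

Lemma integral_convol f g :
  integral_form f -> integral_form g -> integral_form (convol f g).
Proof.
move=> [fL fi] [gL gi]; split=> [a x y|x xX].
  by rewrite /convol comul_linear tensor_form_linear.
rewrite /convol; have [n [u [v [uX vX ->]]]] := order_comul ordX xX.
rewrite tensor_form_sum rpred_sum // => i _.
by rewrite tensor_formE // rpredM ?fi ?gi.
Qed.

Lemma order_dual_basis : exists n (x : 'I_n -> H) (f : 'I_n -> H -> C),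
  [/\ forall i, X (x i), forall i, integral_form (f i)
    & forall y, y = \sum_i f i y *: x i].
Proof.
have [n [x [f [xX fL fR fE]]]] := projective_dual_basis (order_submodule ordX)
  (order_base_change ordX) (order_fg ordX) (order_projective ordX).
by exists n, x, f; split=> // i; split=> // y yX; apply/R_algint/fR.
Qed.

(** In the dual basis, left multiplication by [z] has coefficients [f k (z * x j)], so the matrices
    [rho (x j)] form a family stable under [rho z]; expanding 1 gives the identity matrix. *)
Lemma integral_rep_trace (I : finType) (rho : I -> I -> H -> C) :
    (forall i j, scalar (rho i j)) ->
    (forall i j, rho i j 1 = (i == j)%:R) ->
    (forall i j x y, rho i j (x * y) = \sum_l rho i l x * rho l j y) ->
  integral_form (fun x => \sum_i rho i i x).
Proof.
move=> rL r1 rM; have [n [x [f [xX fi fE]]]] := order_dual_basis.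
split=> [a u v|z zX].
  by rewrite mulr_sumr -big_split; apply: eq_bigr => i _; rewrite rL.
apply: (@algint_trace _ _ n (fun i j => rho i j z) (fun k i j => rho i j (x k))
  (fun j k => f k (z * x j)) (fun j => f j 1)).
- by move=> j k; apply: (fi k).2; apply: (Defs.orderM ordX).
- move=> j i k; rewrite -rM [z * x j in LHS]fE (functional_sum (rL _ _)).
  by apply: eq_bigr => l _; rewrite (functionalZ (rL _ _)).
move=> i k; rewrite -r1 [in RHS](fE 1) (functional_sum (rL _ _)).
by apply: eq_bigr => l _; rewrite (functionalZ (rL _ _)).
Qed.

(** Dual argument: convolution by [f] acts on the forms [g j] with coefficients
    [convol f (g j) (x k)], and expanding the counit, the unit of the dual algebra, gives the
    identity matrix. *)
Lemma integral_form_comatrix (I : finType) (t : I -> I -> H) (f : H -> C) :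
    (forall i j, comul h (t i j) = \sum_l t i l ⊗ t l j) ->
    (forall i j, counit h (t i j) = (i == j)%:R) ->
  integral_form f -> f (\sum_i t i i) \in algint.
Proof.
move=> tD tE fi; have [n [x [g [xX gi gE]]]] := order_dual_basis.
have convolE e i j : scalar e ->
    convol f e (t i j) = \sum_l f (t i l) * e (t l j).
  move=> eL; rewrite /convol tD tensor_form_sum; apply: eq_bigr => l _.
  by rewrite tensor_formE //; apply: fi.1.
rewrite (functional_sum fi.1).
apply: (@algint_trace _ _ n (fun i j => f (t i j)) (fun k i j => g k (t i j))
  (fun j k => convol f (g j) (x k)) (fun j => counit h (x j))).
- by move=> j k; apply: (integral_convol fi (gi j)).2.
- move=> j i k; rewrite -convolE ?(gi j).1 //; last exact: (gi j).1.
  have cL := (integral_convol fi (gi j)).1.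
  rewrite [t i k in LHS]gE (functional_sum cL); apply: eq_bigr => l _.
  by rewrite (functionalZ cL) mulrC.
move=> i k; rewrite -tE [in RHS](gE (t i k)) (functional_sum (counit_linear h)).
by apply: eq_bigr => l _; rewrite (functionalZ (counit_linear h)) mulrC.
Qed.

(** Evaluating the dual basis at [c] writes [c] as a combination of elements of [X] with algebraic
    integer coefficients, so it acts on forms like an element of the order. *)
Lemma integral_form_translate c chi :
    (forall f, integral_form f -> f c \in algint) -> integral_form chi ->
  integral_form (fun z => chi (z * c)).
Proof.
move=> ci [chiL chi_i]; have [n [x [f [xX fi fE]]]] := order_dual_basis.
split=> [a u v|z zX]; first by rewrite mulrDl -scalerAl chiL.
rewrite [c]fE mulr_sumr (functional_sum chiL) rpred_sum // => i _.
rewrite -scalerAr (functionalZ chiL) rpredM ?(ci _ (fi i)) ?chi_i //.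
exact: (Defs.orderM ordX).
Qed.

End HopfOrderIntegrality.

Lemma sum_mul_sum (B : nzRingType) (I : finType) (F G : I -> B) x :
  (\sum_i F i) * x * (\sum_j G j) = \sum_(i : I * I) F i.1 * x * G i.2.
Proof.
rewrite !mulr_suml; under eq_bigr => i _ do rewrite mulr_sumr.
by rewrite pair_bigA.
Qed.

(** * A comodule of the twisted group algebra, and convolution of class functions *)

Section TwistedGroupAlgebra.
Variables (C : numClosedFieldType) (gT : finGroupType) (M : {group gT}).
Hypothesis abM : abelian M.
Local Notation A := (dual C (subg_of M)).
Local Notation H := (group_alg C gT).
Variable omega : A -> A -> C.
Hypothesis omegaP : normalized_2cocycle omega.
Local Notation e := (@idem C gT M).
Local Notation J := (twist_elt e omega).
Local Notation gel := (@gelt C gT).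

Let tL (v : H) : linear ((@tens C H H)^~ v) := (tens_bilin H H).1 v.
Let tR (u : H) : linear (tens u : H -> _) := (tens_bilin H H).2 u.
Let eM := idemM abM (C := C).

Lemma twist_elt_idemM f g :
  twist_elt e f * twist_elt e g = twist_elt e (fun a b => f a b * g a b).
Proof.
have E2M (i j : A * A) : (e i.1 ⊗ e i.2) * (e j.1 ⊗ e j.2) =
    if i == j then e i.1 ⊗ e i.2 else 0.
  case: i j => [a b] [a' b']; rewrite tensM !eM xpair_eqE /=.
  by do 2![case: eqP => _]; rewrite ?(lin0 (tL _)) ?(lin0 (tR _)).
have twE f' : twist_elt e f' = \sum_i f' i.1 i.2 *: (e i.1 ⊗ e i.2).
  exact: (pair_bigA _ (fun a b => f' a b *: (e a ⊗ e b))).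
by rewrite !twE (orthM E2M).
Qed.

Let JU : J \is a GRing.unit.
Proof. exact: (twist_elt_unit eM (idem_sum C abM) omegaP). Qed.

Section Comatrix.
Variable I : finType.

(** The matrix over the group algebra of [M] whose image under each character [a] is [w a]. *)
Definition idem_matrix (w : A -> I -> I -> C) i j : H := \sum_a w a i j *: e a.

Lemma idem_matrix_tens w i j :
  \sum_l idem_matrix w i l ⊗ idem_matrix w l j =
  twist_elt e (fun a b => \sum_l w a i l * w b l j).
Proof.
rewrite /twist_elt.
transitivity (\sum_l \sum_a \sum_b (w a i l * w b l j) *: (e a ⊗ e b)).
  apply: eq_bigr => l _; rewrite /idem_matrix (lin_sum (tL _)).
  apply: eq_bigr => a _; rewrite (linZ (tL _)) (lin_sum (tR _)) scaler_sumr.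
  by apply: eq_bigr => b _; rewrite (linZ (tR _)) scalerA.
rewrite exchange_big; apply: eq_bigr => a _ /=.
rewrite exchange_big; apply: eq_bigr => b _ /=.
by rewrite scaler_suml.
Qed.

Lemma idem_matrix_comul w i j :
  comul (group_hopf C gT) (idem_matrix w i j) =
  twist_elt e (fun a b => w (a * b)%g i j).
Proof.
have cL := comul_linear (group_hopf C gT).
rewrite /idem_matrix (lin_sum cL) /twist_elt.
under eq_bigr => a _ do rewrite (linZ cL) idem_comul // scaler_sumr.
rewrite exchange_big; apply: eq_bigr => a _ /=.
rewrite (reindex_inj (mulgI a)); apply: eq_bigr => b _ /=.
by rewrite mulKg.
Qed.

Lemma idem_matrix_counit w i j :
  counit (group_hopf C gT) (idem_matrix w i j) = w 1%g i j.
Proof.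
have cL := counit_linear (group_hopf C gT).
rewrite /idem_matrix (functional_sum cL).
under eq_bigr => a _ do rewrite (functionalZ cL) idem_counit.
rewrite (bigD1 1%g) //= eqxx mulr1 big1 ?addr0 // => a /negbTE ->.
by rewrite mulr0.
Qed.

Variables u v : A -> I -> I -> C.
Hypothesis uM : forall a b i j,
  \sum_l u a i l * u b l j = omega a b * u (a * b)%g i j.
Hypothesis vM : forall a b i j,
  (\sum_l v a i l * v b l j) * omega a b = v (a * b)%g i j.
Hypothesis u1 : forall i j, u 1%g i j = (i == j)%:R.
Hypothesis v1 : forall i j, v 1%g i j = (i == j)%:R.

(* Matrix coefficients of the comodule, over the subcoalgebra spanned by the
   e_a g e_b, given by the projective representations u and v of the dual of M,
   of multipliers omega and its inverse. *)
Definition twisted_comatrix g (i j : I * I) : H :=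
  idem_matrix u i.1 j.1 * gel g * idem_matrix v i.2 j.2.

(** By [uM], multiplication by [J] turns the coproduct of the left factor into a matrix coproduct;
    by [vM], [J^-1] does the same on the right; the middle factor is grouplike. *)
Lemma twisted_comatrix_comul g i j :
  comul (twisted_group_hopf abM omegaP) (twisted_comatrix g i j) =
  \sum_l twisted_comatrix g i l ⊗ twisted_comatrix g l j.
Proof.
have cM := (comul_morph (group_hopf C gT)).2.
rewrite /= /twisted_comul /twisted_comatrix !cM /= galg_comulE.
have -> : galg_comul (idem_matrix v i.2 j.2) =
    (\sum_l idem_matrix v i.2 l ⊗ idem_matrix v l j.2) * J.
  rewrite idem_matrix_tens twist_elt_idemM [LHS]idem_matrix_comul.
  by apply: twist_elt_eq => a b; rewrite vM.
rewrite !mulrA mulrK //.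
have -> : J * galg_comul (idem_matrix u i.1 j.1) =
    \sum_l idem_matrix u i.1 l ⊗ idem_matrix u l j.1.
  rewrite idem_matrix_tens [galg_comul _]idem_matrix_comul twist_elt_idemM.
  by apply: twist_elt_eq => a b; rewrite uM.
rewrite (@sum_mul_sum (tensor H H)); apply: eq_bigr => -[k l] _ /=.
by rewrite !tensM.
Qed.

Lemma twisted_comatrix_counit g i j :
  counit (twisted_group_hopf abM omegaP) (twisted_comatrix g i j) = (i == j)%:R.
Proof.
have cM := (counit_morph (group_hopf C gT)).2.
rewrite [LHS]cM cM !idem_matrix_counit [counit _ _]galg_counitE u1 v1.
case: i j => [i k] [j l]; rewrite xpair_eqE /=.
by do 2!case: eqP => _; rewrite !(mulr1, mulr0).
Qed.

(** Both traces are concentrated at the trivial character, so each outer factor sums to [#|I|] times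
    [e 1]. *)
Lemma twisted_comatrix_trace g :
    (forall a, \sum_i u a i i = (#|I| * (a == 1%g))%:R) ->
    (forall a, \sum_i v a i i = (#|I| * (a == 1%g))%:R) ->
  \sum_i twisted_comatrix g i i = (#|I| ^ 2)%:R *: (e 1%g * gel g * e 1%g).
Proof.
move=> utr vtr.
have trE w : (forall a, \sum_i w a i i = (#|I| * (a == 1%g))%:R) ->
    \sum_i idem_matrix w i i = #|I|%:R *: e 1%g.
  move=> wtr; rewrite exchange_big (bigD1 1%g) //= [X in _ + X]big1 ?addr0.
    by rewrite -scaler_suml wtr eqxx muln1.
  by move=> a /negbTE a1; rewrite -scaler_suml wtr a1 muln0 scale0r.
transitivity ((\sum_i idem_matrix u i i) * gel g * (\sum_i idem_matrix v i i)).
  by rewrite sum_mul_sum.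
rewrite !trE //; move: (e 1%g) => x.
by rewrite -!scalerAl -scalerAr scalerA -natrM.
Qed.
End Comatrix.

Section ClassFunction.
Variable chi0 : gT -> C.
Hypothesis chi0C : forall a b, chi0 (a * b)%g = chi0 (b * a)%g.

Definition galg_form (z : H) : C := \sum_g z g * chi0 g.
Local Notation chi := galg_form.

Lemma galg_form_scalar : scalar chi.
Proof.
move=> a x y; rewrite mulr_sumr -big_split; apply: eq_bigr => g _ /=.
by rewrite galg_addE galg_scaleE mulrDl mulrA.
Qed.
Let chiL := galg_form_scalar.

Lemma galg_form_gelt g : chi (gel g) = chi0 g.
Proof.
rewrite /chi (bigD1 g) //= ffunE eqxx mul1r big1 ?addr0 // => k /negbTE kg.
by rewrite ffunE kg mul0r.
Qed.

Lemma galg_formC x y : chi (x * y) = chi (y * x).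
Proof.
apply: (galg_ext2 (W := C^o) (f := fun x y => chi (x * y))
  (g := fun x y => chi (y * x))) => {x y} [y|x|y|x|a b].
- by move=> a k l; rewrite mulrDl -scalerAl chiL.
- by move=> a k l; rewrite mulrDr -scalerAr chiL.
- by move=> a k l; rewrite mulrDr -scalerAr chiL.
- by move=> a k l; rewrite mulrDl -scalerAl chiL.
by rewrite !geltM !galg_form_gelt chi0C.
Qed.

(** The tensor square of a trace is a trace; this will let [J] be moved around cyclically. *)
Lemma tensor_galg_formC s t :
  tensor_form chi chi (s * t) = tensor_form chi chi (t * s).
Proof.
have fL := @tensor_form_linear C H chi chi.
apply: (tens_ext (W := C^o) (f := fun s => tensor_form chi chi (s * t))
  (g := fun s => tensor_form chi chi (t * s))) => [a k l|a k l|x y].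
- by rewrite mulrDl -scalerAl fL.
- by rewrite mulrDr -scalerAr fL.
apply: (tens_ext (W := C^o) (f := fun t => tensor_form chi chi (x ⊗ y * t))
  (g := fun t => tensor_form chi chi (t * (x ⊗ y)))) => [a k l|a k l|x' y'].
- by rewrite mulrDr -scalerAr fL.
- by rewrite mulrDl -scalerAl fL.
by rewrite !tensM !tensor_formE // galg_formC [chi (y * _)]galg_formC.
Qed.

Variable g : gT.
Let c : H := #|M|%:R *: (e 1%g * gel g * e 1%g).

Let M0 : #|M|%:R != 0 :> C.
Proof. by rewrite pnatr_eq0 -lt0n cardG_gt0. Qed.

Let e1E : e 1%g = #|M|%:R^-1 *: \sum_(m : subg_of M) gel (sgval m).
Proof.
by rewrite /idem; congr (_ *: _); apply: eq_bigr => m _; rewrite dual1E scale1r.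
Qed.

Let gelt_e1 (m : subg_of M) : gel (sgval m) * e 1%g = e 1%g.
Proof.
rewrite e1E -scalerAr; congr (_ *: _); rewrite mulr_sumr [RHS](reindex_inj (mulgI m)).
by apply: eq_bigr => n _; rewrite geltM.
Qed.
Let e1_gelt (m : subg_of M) : e 1%g * gel (sgval m) = e 1%g.
Proof.
rewrite e1E -scalerAl; congr (_ *: _); rewrite mulr_suml [RHS](reindex_inj (mulIg m)).
by apply: eq_bigr => n _; rewrite geltM.
Qed.

Let cE : c = #|M|%:R^-1 *:
  \sum_(m : subg_of M) \sum_(n : subg_of M) gel (sgval m * g * sgval n)%g.
Proof.
rewrite /c e1E -!scalerAl -scalerAr !scalerA divff // mul1r; congr (_ *: _).
rewrite !mulr_suml; apply: eq_bigr => m _.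
by rewrite mulr_sumr; apply: eq_bigr => n _; rewrite !geltM.
Qed.

Let e1c : e 1%g * c = c.
Proof. by rewrite /c -scalerAr !mulrA eM eqxx. Qed.
Let ce1 : c * e 1%g = c.
Proof. by rewrite /c -scalerAl -!mulrA eM eqxx. Qed.

Let one_e1 : 1 ⊗ e 1%g = twist_elt e (fun a b => (b == 1%g)%:R).
Proof.
rewrite -(idem_sum C abM) (lin_sum (tL _)) /twist_elt; apply: eq_bigr => a _.
rewrite (bigD1 1%g) //= eqxx scale1r big1 ?addr0 // => b /negbTE ->.
by rewrite scale0r.
Qed.

Let J_one_e1 : J * (1 ⊗ e 1%g) = 1 ⊗ e 1%g.
Proof.
rewrite one_e1 twist_elt_idemM; apply: twist_elt_eq => a b.
have [_ w1 _ _] := omegaP.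
by case: eqP => [->|_]; rewrite ?w1 ?mulr1 ?mulr0.
Qed.
Let one_e1_J : (1 ⊗ e 1%g) * J = 1 ⊗ e 1%g.
Proof.
rewrite -[RHS]J_one_e1 one_e1 !twist_elt_idemM; apply: twist_elt_eq => a b.
by rewrite mulrC.
Qed.

(** The normalized cocycle is 1 against the trivial character, so [J] fixes [1 ⊗ c] on both sides
    and cancels; what remains is computed with the untwisted coproduct. *)
Lemma convol_galg_form :
  convol (twisted_group_hopf abM omegaP) chi (fun z => chi (z * c)) c =
  (\sum_(m in M) chi0 (m * g)%g) *
  (\sum_(m in M) \sum_(n in M) chi0 (m * g * (n * g))%g) / #|M|%:R.
Proof.
have sgM (F : gT -> C) : \sum_(m in M) F m = \sum_(m : subg_of M) F (sgval m).
  rewrite (reindex (@sgval _ M)) /=; first by apply: eq_bigl => m; rewrite subgP.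
  by exists (subg M) => m mM; rewrite ?sgvalK ?subgK.
have chicL : scalar (fun z => chi (z * c)).
  by move=> a k l; rewrite mulrDl -scalerAl chiL.
have formE s : tensor_form chi (fun z => chi (z * c)) s =
    tensor_form chi chi (s * (1 ⊗ c)).
  apply: (tens_ext (W := C^o) (f := tensor_form chi (fun z => chi (z * c)))
    (g := fun s => tensor_form chi chi (s * (1 ⊗ c)))) => [||x y].
  - exact: tensor_form_linear.
  - by move=> a k l; rewrite mulrDl -scalerAl tensor_form_linear.
  by rewrite tensM mulr1 !tensor_formE.
have Jc : J^-1 * (1 ⊗ c) = 1 ⊗ c.
  have Jc1 : J * (1 ⊗ c) = 1 ⊗ c.
    by have := tensM (1 : H) (1 : H) (e 1%g) c; rewrite mulr1 e1c => <-; rewrite mulrA J_one_e1.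
  by rewrite -[in LHS]Jc1 mulKr.
have cJ : (1 ⊗ c) * J = 1 ⊗ c.
  by rewrite -[X in 1 ⊗ X]ce1 -[X in X ⊗ _]mulr1 -tensM -mulrA one_e1_J.
rewrite /convol formE.
have -> : comul (twisted_group_hopf abM omegaP) c = J * comul (group_hopf C gT) c * J^-1 by [].
(* [1 ⊗ c] absorbs [J^-1] on its left; the trace property then carries [J] to its right, where it is
   absorbed too. *)
rewrite -mulrA Jc -mulrA tensor_galg_formC.
rewrite -mulrA cJ -formE.
have cL := comul_linear (group_hopf C gT).
have fL := @tensor_form_linear C H chi (fun z => chi (z * c)).
have gcE : chi (gel g * c) =
    #|M|%:R^-1 * \sum_(m in M) \sum_(n in M) chi0 (m * g * (n * g))%g.
  rewrite cE -scalerAr (functionalZ chiL); congr (_ * _).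
  rewrite mulr_sumr (functional_sum chiL) [RHS]exchange_big sgM; apply: eq_bigr => m _ /=.
  rewrite mulr_sumr (functional_sum chiL) sgM; apply: eq_bigr => n _.
  by rewrite geltM galg_form_gelt mulgA chi0C !mulgA.
(* Multiplication by [M] on either side fixes [c], so the second factor is constant on the double
   coset of [g]. *)
have cosetE (m n : subg_of M) : chi (gel (sgval m * g * sgval n)%g * c) = chi (gel g * c).
  have nc : gel (sgval n) * c = c by rewrite -[RHS]e1c -(gelt_e1 n) -mulrA e1c.
  have cm : c * gel (sgval m) = c by rewrite -[RHS]ce1 -(e1_gelt m) mulrA ce1.
  by rewrite -!geltM -!mulrA nc galg_formC -mulrA cm.
have comulE : comul (group_hopf C gT) c = #|M|%:R^-1 *: \sum_(m : subg_of M)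
    \sum_(n : subg_of M) gel (sgval m * g * sgval n)%g ⊗ gel (sgval m * g * sgval n)%g.
  rewrite [in LHS]cE (linZ cL) (lin_sum cL); congr (_ *: _).
  apply: eq_bigr => m _; rewrite (lin_sum cL); apply: eq_bigr => n _.
  exact: galg_comulE.
rewrite comulE (@linZ C (tensor H H) C^o _ fL) tensor_form_sum.
(* Since [chi0] is central, [m * g * n] contributes as [n * m * g], and each element of [M] is
   reached [#|M|] times. *)
transitivity (#|M|%:R^-1 * \sum_(m in M) \sum_(n in M)
    chi0 (m * g)%g * chi (gel g * c)).
  congr (_ * _); rewrite [RHS]exchange_big [RHS]sgM.
  rewrite (eq_bigr (fun m : subg_of M => \sum_(n : subg_of M)
      chi0 (sgval m * g * sgval n)%g * chi (gel g * c))); last first.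
    move=> m _; rewrite tensor_form_sum; apply: eq_bigr => n _.
    by rewrite tensor_formE // cosetE galg_form_gelt.
  rewrite exchange_big /=; apply: eq_bigr => n _; rewrite sgM.
  rewrite [RHS](reindex_inj (mulgI n)); apply: eq_bigr => m _.
  by rewrite chi0C !mulgA.
under eq_bigr => m _ do rewrite sumr_const -mulr_natr.
rewrite -!mulr_suml gcE [_ * #|M|%:R]mulrC mulrA mulVf // mul1r.
by rewrite mulrA mulrAC.
Qed.
End ClassFunction.
End TwistedGroupAlgebra.

(** * The permutation character on the cosets of a subgroup *)

Section CosetCharacter.
Variables (gT : finGroupType) (P : {group gT}).

Definition coset_fix (h : gT) : nat :=
  #|[set A in rcosets P [set: gT] | (A :* h)%g == A]|.

Lemma rcosets_stable A h :
  A \in rcosets P [set: gT] -> (A :* h)%g \in rcosets P [set: gT].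
Proof.
by case/rcosetsP => x _ ->; apply/rcosetsP; exists (x * h)%g; rewrite ?inE ?rcosetM.
Qed.

(** The p-group generated by a p-element fixes, modulo [p], as many cosets as there are. An element
    fixing a coset lies in a conjugate of [P], hence is a p-element. *)
Lemma coset_fix_Sylow p h : prime p -> (p.-Sylow([set: gT]) P)%g ->
  coset_fix h = ((p.-elt h)%g * #|[set: gT] : P|%g)%N %[mod p].
Proof.
move=> p_pr sylP; have [hp|hnp] := boolP (p.-elt h)%g.
  rewrite mul1n; have -> : coset_fix h = #|('Fix_(rcosets P [set: gT] | 'Rs)(<[h]>))%g|.
    apply: eq_card => A; rewrite [LHS]inE [RHS]inE; congr (_ && _).
    rewrite afix_cycle ?inE //.
    by rewrite finset.sub1set inE /= rcosetE.
  apply/esym/pgroup_fix_mod; first exact: hp.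
  apply/actsP => x _ A; rewrite /= rcosetE.
  apply/idP/idP => [|AR]; last exact: rcosets_stable.
  by move/(rcosets_stable x^-1%g); rewrite -rcosetM mulgV rcoset1.
suff -> : coset_fix h = 0%N by rewrite mul0n.
apply/eqP; rewrite cards_eq0; apply: contraNT hnp => /set0Pn[A].
rewrite inE => /andP[/rcosetsP[x _ ->] /eqP]; rewrite -rcosetM => xhx.
have : (x * h)%g \in (P :* x)%g by rewrite -xhx rcoset_refl.
rewrite mem_rcoset => hx.
have : (p.-elt (h ^ x^-1))%g.
  by apply: (mem_p_elt (pHall_pgroup sylP)); rewrite conjgE invgK mulgA.
by rewrite /p_elt orderJ.
Qed.

Definition coset_type : predArgType := {A | A \in rcosets P [set: gT]}.
(** The permutation representation with character [coset_fix], in the matrix form required by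
    [integral_rep_trace]. *)
Definition coset_mat (h : gT) (i j : coset_type) : bool := (val i :* h)%g == val j.

Lemma coset_mat1 i j : coset_mat 1%g i j = (i == j).
Proof. by rewrite /coset_mat rcoset1. Qed.

Lemma coset_matM a b i j :
  coset_mat (a * b)%g i j = (\sum_l coset_mat a i l * coset_mat b l j)%N :> nat.
Proof.
pose k : coset_type := Sub (val i :* a)%g (rcosets_stable a (valP i)).
rewrite (bigD1 k) //= [X in (_ + X)%N]big1 ?addn0.
  by rewrite /coset_mat SubK eqxx mul1n rcosetM.
by move=> l lk; rewrite /coset_mat -[_ == val l]/(val k == val l) (inj_eq val_inj)
  eq_sym (negbTE lk).
Qed.

Lemma coset_fix_trace h : coset_fix h = (\sum_i coset_mat h i i)%N.
Proof.
have -> : coset_fix h = #|val @: [set i | coset_mat h i i]|.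
  apply: eq_card => A; rewrite inE; apply/andP/imsetP => [[AR Ah]|[j]].
    by exists (Sub A AR : coset_type); rewrite ?inE.
  by rewrite inE => jh ->; split; [apply: (valP j)|].
rewrite card_imset; last exact: val_inj.
by rewrite -sum1dep_card big_mkcond; apply: eq_bigr => i _; case: coset_mat.
Qed.

Lemma coset_fixC a b : coset_fix (a * b) = coset_fix (b * a).
Proof.
rewrite !coset_fix_trace; under eq_bigr => i _ do rewrite coset_matM.
under [RHS]eq_bigr => i _ do rewrite coset_matM.
rewrite exchange_big; apply: eq_bigr => i _; apply: eq_bigr => j _.
exact: mulnC.
Qed.
End CosetCharacter.

(** * The Heisenberg cocycle for a subgroup isomorphic to the additive group of F x F *)

Section AdditiveSubgroup.
Variables (C : numClosedFieldType) (F : finFieldType) (gT : finGroupType).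
Variable E : F * F -> gT.
Hypothesis ED : forall x y, E (x + y) = (E x * E y)%g.
Hypothesis E_inj : injective E.

Definition add_subgroup : {set gT} := E @: [set: F * F].

Lemma add_subgroup_group_set : group_set add_subgroup.
Proof.
apply/group_setP; split=> [|_ _ /imsetP[x _ ->] /imsetP[y _ ->]].
  apply/imsetP; exists 0 => //; apply: (mulgI (E 0)).
  by rewrite mulg1 -ED addr0.
by rewrite -ED imset_f.
Qed.
Canonical add_subgroup_group := Group add_subgroup_group_set.
Local Notation M := add_subgroup_group.
Local Notation A := (dual C (subg_of M)).

Lemma add_subgroup_abelian : abelian M.
Proof.
by apply/centsP => _ /imsetP[x _ ->] _ /imsetP[y _ ->]; rewrite /commute -!ED addrC.
Qed.

Lemma card_add_subgroup : #|M| = (#|F| ^ 2)%N.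
Proof. by rewrite card_imset // cardsT card_prod. Qed.

Lemma sum_add_subgroup (V : nmodType) (f : gT -> V) :
  \sum_(m in M) f m = \sum_x f (E x).
Proof. by rewrite big_imset //=; [apply: eq_bigl => x; rewrite inE | move=> x y _ _ /E_inj]. Qed.

Let E0 : E 0 = 1%g.
Proof. by apply: (mulgI (E 0)); rewrite mulg1 -ED addr0. Qed.

Let sE x : subg_of M := subg M (E x).
Let sEK x : sgval (sE x) = E x.
Proof. by rewrite subgK // imset_f. Qed.
Let sED x y : sE (x + y) = (sE x * sE y)%g.
Proof. by apply: subg_inj; rewrite sEK ED -!sEK. Qed.
Let sE_inj : injective sE.
Proof. by move=> x y /(congr1 sgval); rewrite !sEK => /E_inj. Qed.

Let sE0 : sE 0 = 1%g.
Proof. by apply: subg_inj; rewrite sEK E0. Qed.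

Let E_coord (m : subg_of M) : exists x, sE x == m.
Proof.
have /imsetP[x _ mE] : sgval m \in M := subgP m.
by exists x; apply/eqP/subg_inj; rewrite sEK.
Qed.
Let coord m := xchoose (E_coord m).
Let coordK m : sE (coord m) = m.
Proof. exact/eqP/(xchooseP (E_coord m)). Qed.
Let sEcoord x : coord (sE x) = x.
Proof. by apply: sE_inj; rewrite coordK. Qed.

Let sgC (x y : subg_of M) : (x * y = y * x)%g.
Proof. by rewrite -[x]coordK -[y]coordK -!sED addrC. Qed.

(** Characters separate the elements of an abelian group. Restricted to the first coordinate, such a
    character gives the nontrivial additive character [tau] of [F]. *)
Let tau_ex : exists phi : A, phi (sE (1, 0)) != 1.
Proof.
apply/existsP; apply: contraT => /existsPn tr.
have : sE (1, 0) = 1%g.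
  by apply: (dual_separates (C := C) sgC) => phi; apply/eqP/negPn/tr.
by rewrite -sE0 => /sE_inj/eqP; rewrite xpair_eqE oner_eq0.
Qed.
Let phi0 := xchoose tau_ex.
Let tau (a : F) : C := phi0 (sE (a, 0)).
Let tauD a b : tau (a + b) = tau a * tau b.
Proof. by rewrite /tau -dualM -sED -[in LHS](addr0 0). Qed.
Let tau0 : tau 0 = 1.
Proof. by rewrite /tau sE0 dual1. Qed.
Let tau1 : tau 1 != 1.
Proof. exact: (xchooseP tau_ex). Qed.
Let tau_neq0 a : tau a != 0.
Proof. exact: dual_neq0. Qed.
(** For nonzero [c], shifting [k] by [c^-1] multiplies the sum by [tau 1], which is not 1. *)
Let tau_sum c : \sum_k tau (c * k) = (#|F| * (c == 0))%:R.
Proof.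
have [->|c0] := eqVneq c 0.
  under eq_bigr => k _ do rewrite mul0r tau0.
  by rewrite sumr_const muln1.
rewrite muln0; apply: (@mulfI _ (tau 1 - 1)); first by rewrite subr_eq0.
rewrite mulr0 mulrBl mul1r mulr_sumr [X in _ - X](reindex_inj (addrI c^-1)) /=.
apply/eqP; rewrite subr_eq0; apply/eqP; apply: eq_bigr => k _.
by rewrite mulrDr divff // tauD.
Qed.

Let char_of_subproof (s : F * F) :
  is_character [ffun m : subg_of M => tau (s.1 * (coord m).1 + s.2 * (coord m).2)].
Proof.
rewrite /is_character ffunE -sE0 sEcoord /= !mulr0 addr0 tau0 eqxx.
apply/forallP => x; apply/forallP => y; rewrite !ffunE -tauD.
have -> : coord (x * y) = coord x + coord y.
  by apply: sE_inj; rewrite sED !coordK.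
by rewrite /= !mulrDr addrACA.
Qed.
Let char_of s : A := Dual (char_of_subproof s).
Let char_ofE s x : char_of s (sE x) = tau (s.1 * x.1 + s.2 * x.2).
Proof. by rewrite ffunE sEcoord. Qed.

Let char_ofD s t : char_of (s + t) = (char_of s * char_of t)%g.
Proof.
apply: dual_eq => m; rewrite dualME -[m]coordK !char_ofE -tauD.
by rewrite /= !mulrDl addrACA.
Qed.

Let char_of_inj : injective char_of.
Proof.
move=> s t st; apply/eqP; rewrite -subr_eq0; apply/eqP.
have {st} d1 : char_of (s - t) = 1%g.
  by apply: (mulIg (char_of t)); rewrite -char_ofD subrK mul1g.
move: (s - t) d1 => [a b] d1.
have d x : tau (a * x.1 + b * x.2) = 1 by rewrite -(char_ofE (a, b)) d1 dual1E.
(* If a coordinate were nonzero, evaluation at its inverse would give [tau 1 = 1]. *)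
congr pair; apply/eqP; apply: contraNT tau1 => z0; apply/eqP.
  by have := d (a^-1, 0); rewrite /= mulr0 addr0 divff.
by have := d (0, b^-1); rewrite /= mulr0 add0r divff.
Qed.

(** Orthogonality at the identity counts the characters; being injective, [char_of] then reaches all
    of them, which gives coordinates on the dual. *)
Let card_dual : #|{: A}| = #|{: F * F}|.
Proof.
have := dual_sum C sgC 1%g; rewrite eqxx muln1.
under eq_bigr => phi _ do rewrite dual1.
rewrite sumr_const => /eqP; rewrite eqr_nat => /eqP ->.
by rewrite card_sub (eq_card (B := M)) // card_add_subgroup card_prod.
Qed.

Let char_ex (phi : A) : exists s, char_of s == phi.
Proof.
have : phi \in codom char_of.
  by rewrite (inj_card_onto char_of_inj) // card_dual.
by case/codomP => s ->; exists s.
Qed.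
Let dcoord phi := xchoose (char_ex phi).
Let dcoordK phi : char_of (dcoord phi) = phi.
Proof. exact/eqP/(xchooseP (char_ex phi)). Qed.
Let dcoordD phi psi : dcoord (phi * psi)%g = dcoord phi + dcoord psi.
Proof. by apply: char_of_inj; rewrite char_ofD !dcoordK. Qed.
Let dcoord1 : dcoord 1%g = 0.
Proof. by apply: (addrI (dcoord 1%g)); rewrite -dcoordD mulg1 addr0. Qed.
Let dcoord_eq0 phi : (dcoord phi == 0) = (phi == 1%g).
Proof.
apply/eqP/eqP => [p0|->]; last exact: dcoord1.
by rewrite -[phi]dcoordK p0 -dcoord1 dcoordK.
Qed.

(** The cocycle is a bicharacter in the coordinates of the dual. Its projective representation of
    degree [#|F|] exhibits [c] as the trace of a comodule, at which the convolution of two integral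
    forms is evaluated. *)
Lemma twist_convol_algint : exists omega : A -> A -> C,
  exists omegaP : normalized_2cocycle omega,
  forall (R : subringClosed C) (X : set (group_alg C gT)) (P : {group gT}) g,
    {subset R <= algint} ->
    hopf_order R (twisted_group_hopf add_subgroup_abelian omegaP) X ->
  ((\sum_x coset_fix P (E x * g)%g) *
   (\sum_x \sum_y coset_fix P (E x * g * (E y * g))%g))%:R / (#|F| ^ 2)%:R
    \in @algint C.
Proof.
pose omega (phi psi : A) := tau ((dcoord phi).1 * (dcoord psi).2).
have omegaP : normalized_2cocycle omega.
  split=> [x y|x|x|x y z]; rewrite /omega ?tau_neq0 ?dcoord1 ?mulr0 ?mul0r //.
  rewrite -!tauD !dcoordD /= mulrDl mulrDr; congr tau.
  by rewrite addrA addrC.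
exists omega, omegaP => R X P g Ri ordX.
(* Clock and shift matrices on the functions on F. *)
pose u (phi : A) (k l : F) : C :=
  tau ((dcoord phi).1 * l) * (k == l + (dcoord phi).2)%:R.
pose v (phi : A) (k l : F) : C :=
  tau (- ((dcoord phi).1 * l)) * (k == l + (dcoord phi).2)%:R.
have uM a b i j : \sum_l u a i l * u b l j = omega a b * u (a * b)%g i j.
  rewrite (bigD1 (j + (dcoord b).2)) //= big1 => [|l /negbTE lj]; last first.
    by rewrite /u lj !mulr0.
  rewrite addr0 /u eqxx mulr1 /omega dcoordD /= -addrA [(dcoord b).2 + _]addrC.
  rewrite mulrAC mulrA -!tauD mulrDr mulrDl -!addrA; congr (tau _ * _).
  by rewrite addrCA.
have vM a b i j : (\sum_l v a i l * v b l j) * omega a b = v (a * b)%g i j.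
  rewrite (bigD1 (j + (dcoord b).2)) //= big1 => [|l /negbTE lj]; last first.
    by rewrite /v lj !mulr0.
  rewrite addr0 /v eqxx mulr1 /omega dcoordD /= -addrA [(dcoord b).2 + _]addrC.
  rewrite mulrAC [X in X * _]mulrAC mulrAC -!tauD mulrDr mulrDl; congr (tau _ * _).
  by rewrite !opprD addrNK.
have u1 i j : u 1%g i j = (i == j)%:R by rewrite /u dcoord1 mul0r addr0 tau0 mul1r.
have v1 i j : v 1%g i j = (i == j)%:R.
  by rewrite /v dcoord1 mul0r addr0 oppr0 tau0 mul1r.
have trE (w : F -> F) (phi : A) : w = id \/ w = -%R ->
   \sum_i tau (w ((dcoord phi).1 * i)) * (i == i + (dcoord phi).2)%:R =
   (#|F| * (phi == 1%g))%:R :> C.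
  move=> wE; rewrite -dcoord_eq0; case: (dcoord phi) => a b /=.
  under eq_bigr => i _ do rewrite -[X in X == _]addr0 (inj_eq (addrI i)) eq_sym.
  rewrite -mulr_suml xpair_eqE andbC.
  have -> : \sum_i tau (w (a * i)) = (#|F| * (a == 0))%:R.
    case: wE => ->; first exact: tau_sum.
    rewrite -(tau_sum a) [RHS](reindex_inj oppr_inj) /=.
    by apply: eq_bigr => i _; rewrite mulrN.
  by case: (b == 0); rewrite ?mulr1 ?mulr0 ?muln0.
have utr a : \sum_i u a i i = (#|F| * (a == 1%g))%:R by apply: (trE id); left.
have vtr a : \sum_i v a i i = (#|F| * (a == 1%g))%:R by apply: (trE -%R); right.
pose chi0 h : C := (coset_fix P h)%:R.
have chi0C a b : chi0 (a * b)%g = chi0 (b * a)%g by rewrite /chi0 coset_fixC.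
pose chi := galg_form chi0.
have chi_int : integral_form X chi.
  have -> : chi = fun z => \sum_i galg_form (fun h => (coset_mat (P := P) h i i)%:R) z.
    apply: funext => z; rewrite exchange_big; apply: eq_bigr => h _ /=.
    by rewrite -mulr_sumr /chi0 coset_fix_trace natr_sum.
  pose rho i j := galg_form (fun h => (coset_mat (P := P) h i j)%:R : C).
  have rhoL i j : scalar (rho i j) by apply: galg_form_scalar.
  apply: (integral_rep_trace Ri ordX (rho := rho)) => [//|i j|i j].
    by rewrite -gelt1 /rho galg_form_gelt coset_mat1.
  apply: (galg_ext2 (W := C^o) (f := fun x y => rho i j (x * y))
    (g := fun x y => \sum_l rho i l x * rho l j y)) => [y|x|y|x|a b].
  - by move=> a k l; rewrite mulrDl -scalerAl rhoL.
  - by move=> a k l; rewrite mulrDr -scalerAr rhoL.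
  - move=> a k l; rewrite scaler_sumr -big_split; apply: eq_bigr => n _ /=.
    by rewrite rhoL mulrDl -mulrA.
  - move=> a k l; rewrite scaler_sumr -big_split; apply: eq_bigr => n _ /=.
    by rewrite rhoL mulrDr mulrCA.
  rewrite geltM /rho galg_form_gelt coset_matM natr_sum; apply: eq_bigr => l _.
  by rewrite !galg_form_gelt natrM.
have := convol_galg_form add_subgroup_abelian omegaP chi0C g.
set c := _ *: _ => cE.
(* Since [#|M|] is the square of the degree of [u] and [v], [c] is exactly the trace of the
   comatrix. *)
have c_int f : integral_form X f -> f c \in algint.
  move=> fi; rewrite /c card_add_subgroup.
  rewrite -(twisted_comatrix_trace g utr vtr).
  apply: (integral_form_comatrix Ri ordX) => // i j.
    exact: twisted_comatrix_comul.
  exact: twisted_comatrix_counit.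
have : convol (twisted_group_hopf add_subgroup_abelian omegaP) chi
    (fun z => chi (z * c)) c \in algint.
  apply: (c_int); apply: (integral_convol ordX) => //.
  exact: (integral_form_translate Ri ordX c_int chi_int).
rewrite cE card_add_subgroup sum_add_subgroup sum_add_subgroup.
rewrite (_ : \sum_x \sum_(n in M) _ =
    (\sum_x \sum_y coset_fix P (E x * g * (E y * g))%g)%:R).
  by rewrite -natr_sum -natrM.
by rewrite natr_sum; apply: eq_bigr => x _; rewrite sum_add_subgroup natr_sum.
Qed.

End AdditiveSubgroup.

(** Modulo [p], each p-element contributes the index of [P], which is prime to [p], and the other
    elements contribute 0. *)
Lemma sum_coset_fix_Sylow (gT : finGroupType) (P : {group gT}) p (I : finType) (f : I -> gT) :
    prime p -> (p.-Sylow([set: gT]) P)%g ->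
    ~~ (p %| #|[set i | (p.-elt (f i))%g]|)%N ->
  ~~ (p %| \sum_i coset_fix P (f i))%N.
Proof.
move=> p_pr sylP pf; rewrite /dvdn.
have -> : (\sum_i coset_fix P (f i) =
    \sum_i ((p.-elt (f i))%g * #|[set: gT] : P|%g) %[mod p])%N.
  elim/big_ind2: _ => // [a b c d ab cd|i _]; last exact: coset_fix_Sylow.
  by rewrite -modnDm ab cd modnDm.
rewrite -big_distrl /= -/(p %| _)%N Euclid_dvdM // negb_or.
have -> : (\sum_i (p.-elt (f i))%g)%N = #|[set i | (p.-elt (f i))%g]|.
  by rewrite -sum1dep_card [RHS]big_mkcond; apply: eq_bigr => i _; case: (p_elt _ _).
rewrite pf /=; have /and3P[_ _] := sylP.
by rewrite p'natE.
Qed.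

(** A Hopf order would make [#|F| ^ 2], hence [p], divide the product of two sums that are both
    prime to [p] when [P] is a Sylow subgroup. *)
Theorem twist_without_order (C : numClosedFieldType) (F : finFieldType)
    (gT : finGroupType) (E : F * F -> gT) (g : gT) p :
    {morph E : x y / x + y >-> (x * y)%g} -> injective E ->
    prime p -> (p %| #|F|)%N ->
    ~~ (p %| #|[set x | (p.-elt (E x * g))%g]|)%N ->
    ~~ (p %| #|[set x : _ * _ | (p.-elt (E x.1 * g * (E x.2 * g)))%g]|)%N ->
  exists (M : {group gT}) (abM : abelian M)
         (omega : dual C (subg_of M) -> dual C (subg_of M) -> C)
         (omegaP : normalized_2cocycle omega),
  forall (R : subringClosed C) (X : set (group_alg C gT)), {subset R <= algint} ->
    ~ hopf_order R (twisted_group_hopf abM omegaP) X.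
Proof.
move=> ED Einj p_pr pF h1 h2.
have [omega [omegaP orderE]] := twist_convol_algint C ED Einj.
exists (add_subgroup_group ED), (add_subgroup_abelian ED), omega, omegaP.
move=> R X Ri ordX; have [P sylP] := Sylow_exists p [set: gT].
have F0 : (0 < #|F| ^ 2)%N by rewrite expn_gt0; apply/orP; left; apply/card_gt0P; exists 0.
have /(algint_divn F0) := orderE R X P g Ri ordX.
move/(dvdn_trans (dvdn_exp (isT : 0 < 2)%N pF)).
rewrite pair_bigA Euclid_dvdM // => /orP[]; apply/negP.
  exact: sum_coset_fix_Sylow.
exact: (sum_coset_fix_Sylow (f := fun x => (E x.1 * g * (E x.2 * g))%g)).
Qed.

(** * Matrices having a scalar p-power *)

Section FrobeniusPower.
Variables (R : nzRingType) (p : nat) (pR : p \in [pchar R]).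

(** Iterated Frobenius for commuting elements; it will also be applied in a matrix ring over
    [{poly F}]. *)
Lemma exprBpn_comm (x y : R) k : GRing.comm x y ->
  (x - y) ^+ (p ^ k) = x ^+ (p ^ k) - y ^+ (p ^ k).
Proof.
move=> cxy; elim: k => [|k IH]; first by rewrite !expr1.
rewrite !expnSr !exprM IH -!(pFrobenius_autE pR) pFrobenius_autB_comm //.
exact/commrX/commr_sym/commrX/commr_sym.
Qed.

End FrobeniusPower.

Section ScalarMatrix.
Variables (F : fieldType) (n : nat).

Lemma det_transvection (i j : 'I_n) : i != j ->
  \det (1%:M + delta_mx i j : 'M[F]_n) = 1.
Proof.
wlog ji : i j / (j < i)%N => [W ij|ij].
  have := ij; rewrite -(inj_eq val_inj) neq_ltn => /orP[lt_ij|/W]; last exact.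
  by rewrite -det_tr linearD /= trmx1 trmx_delta W // eq_sym.
rewrite det_trig; last first.
  apply/is_trig_mxP => k l kl; rewrite !mxE -[k == l]val_eqE /= (ltn_eqF kl) add0r.
  by case: eqP => [ki|//]; case: eqP => [lj|//]; move: kl; rewrite ki lj ltnNge ltnW.
rewrite big1 // => k _; rewrite !mxE eqxx.
by case: (k =P i) => [->|_]; rewrite ?(negbTE ij) ?addr0.
Qed.

(** Commuting with a transvection is commuting with an off-diagonal matrix unit, and comparing
    entries leaves only scalars. Transvections are used because they lie in SL. *)
Lemma scalar_mx_transvection (A : 'M[F]_n.+1) :
    (forall i j, i != j -> A *m (1%:M + delta_mx i j) = (1%:M + delta_mx i j) *m A) ->
  is_scalar_mx A.
Proof.
move=> cA.
have {}cA i j k l : i != j -> (l == j)%:R * A k i = (k == i)%:R * A j l.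
  move=> /cA; rewrite mulmxDr mulmxDl mulmx1 mul1mx => /addrI/matrixP/(_ k l).
  rewrite !mxE (bigD1 i) //= big1 ?addr0 => [|h hi]; last first.
    by rewrite mxE (negbTE hi) mulr0.
  rewrite (bigD1 j) //= big1 ?addr0 => [|h hi]; last first.
    by rewrite mxE (negbTE hi) andbF mul0r.
  by rewrite !mxE !eqxx andbT /= mulrC.
apply/is_scalar_mxP; exists (A 0 0); apply/matrixP => i j; rewrite mxE.
have [<-|ij] := eqVneq i j; last first.
  by have := cA j i i i; rewrite eq_sym ij eqxx mul1r (negbTE ij) mul0r => ->.
have [->|i0] := eqVneq i 0; first by [].
by have := cA i 0 i 0 i0; rewrite !eqxx !mul1r.
Qed.

End ScalarMatrix.

Section CharPolyPower.
Variables (F : finFieldType) (p : nat) (pF : p \in [pchar F]) (n : nat).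
Implicit Types A : 'M[F]_n.+1.

(** Frobenius is injective, hence bijective on a finite field. *)
Lemma finField_root_pX k (a : F) : exists b, b ^+ (p ^ k) = a.
Proof.
have inj : injective (fun b : F => b ^+ (p ^ k)).
  move=> b c /eqP; rewrite -subr_eq0 -(exprBpn_comm pF); last exact: mulrC.
  by rewrite expf_eq0 => /andP[_]; rewrite subr_eq0 => /eqP.
have [g fg gf] := injF_bij inj.
by exists (g a); apply: gf.
Qed.

(** With [q = p ^ k] and [b ^+ q = a], the q-th power of [X - A] is the scalar [X^q - a], which is
    the q-th power of [X - b]. Take determinants and use that the q-th power is injective on
    [{poly F}]. *)
Lemma scalar_pX_char_poly A k : is_scalar_mx (A ^+ (p ^ k)) ->
  exists b, char_poly A = ('X - b%:P) ^+ n.+1.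
Proof.
case/is_scalar_mxP => a Aa; have [b ba] := finField_root_pX k a.
exists b; set q := (p ^ k)%N in Aa ba.
have pP : p \in [pchar {poly F}] by rewrite pchar_poly.
have pM : p \in [pchar 'M[{poly F}]_n.+1].
  exact: (rmorph_pchar (@scalar_mx {poly F} n.+1) pP).
have inj (f g : {poly F}) : f ^+ q = g ^+ q -> f = g.
  move=> /eqP; rewrite -subr_eq0 -(exprBpn_comm pP); last exact: mulrC.
  by rewrite expf_eq0 => /andP[_]; rewrite subr_eq0 => /eqP.
apply: inj; rewrite /char_poly -exprM mulnC exprM.
have detX (B : 'M[{poly F}]_n.+1) m : \det (B ^+ m) = \det B ^+ m.
  by elim: m => [|m IH]; rewrite ?det1 // !exprS det_mulmx IH.
rewrite -detX /char_poly_mx (exprBpn_comm pM); last first.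
  exact: comm_scalar_mx.
rewrite -rmorphXn /= -rmorphXn /= -/q Aa.
rewrite map_scalar_mx -rmorphB det_scalar /= -ba rmorphXn /= -(exprBpn_comm pP) //.
exact: mulrC.
Qed.

(** By Cayley-Hamilton [A - b] is nilpotent of index at most [n.+1], and [p ^ n.+1] is at least
    [n.+1]. *)
Lemma char_poly_scalar_pX A b : char_poly A = ('X - b%:P) ^+ n.+1 ->
  exists k, is_scalar_mx (A ^+ (p ^ k)).
Proof.
move=> Ab; exists n.+1; apply/is_scalar_mxP; exists (b ^+ (p ^ n.+1)).
have pP : p \in [pchar {poly F}] by rewrite pchar_poly.
have : horner_mx A (('X - b%:P) ^+ (p ^ n.+1)) = 0.
  have ltn : (n.+1 <= p ^ n.+1)%N.
    by apply/ltnW/ltn_expl/prime_gt1/(pcharf_prime pF).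
  by rewrite -(subnK ltn) exprD rmorphM /= -Ab Cayley_Hamilton mulr0.
rewrite (exprBpn_comm pP); last exact: mulrC.
rewrite rmorphB !rmorphXn /= horner_mx_X horner_mx_C -rmorphXn => /eqP.
by rewrite subr_eq0 => /eqP.
Qed.
End CharPolyPower.

(** * Elements of p-power order in PSL *)

Section PSLElements.
Variables (F : finFieldType) (n : nat).
Implicit Types A B : 'M[F]_n.+1.
Local Notation SLn := (SL n.+1 F).
Local Notation Z := ('Z(SL n.+1 F))%g.

Definition GL_of A : {'GL_n.+1[F]} := insubd (1%g : {'GL_n.+1[F]}) A.

Lemma GL_ofK A : \det A = 1 -> GLval (GL_of A) = A.
Proof. by move=> dA; apply: insubdK; rewrite unitmxE dA unitr1. Qed.

Lemma GL_of_SL A : \det A = 1 -> GL_of A \in SLn.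
Proof. by move=> dA; rewrite inE GL_ofK // dA. Qed.

Lemma GL_of_eqP A (x : {'GL_n.+1[F]}) : \det A = 1 -> GLval x = A -> GL_of A = x.
Proof. by move=> dA xA; apply: val_inj; rewrite /= GL_ofK. Qed.

Definition PSL_of A : PSL n.+1 F := subg _ (coset Z (GL_of A)).

Let normZ A : \det A = 1 -> GL_of A \in 'N(Z)%g.
Proof. by move=> dA; apply: (fintype.subsetP (gFnorm _ _)); apply: GL_of_SL. Qed.

Let quoZ A : \det A = 1 -> coset Z (GL_of A) \in (SLn / Z)%g.
Proof. by move=> dA; apply: mem_quotient; apply: GL_of_SL. Qed.

Lemma PSL_ofM A B : \det A = 1 -> \det B = 1 ->
  PSL_of (A *m B) = (PSL_of A * PSL_of B)%g.
Proof.
move=> dA dB; rewrite /PSL_of -subgM ?quoZ // -morphM ?normZ //=.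
congr (subg _ (coset _ _)); apply: GL_of_eqP; first by rewrite det_mulmx dA dB mulr1.
by rewrite GL_MxE !GL_ofK.
Qed.

Lemma PSL_ofX A k : \det A = 1 -> PSL_of (A ^+ k) = (PSL_of A ^+ k)%g.
Proof.
move=> dA; have dX j : \det (A ^+ j) = 1.
  by elim: j => [|j IH]; rewrite ?det1 // exprS det_mulmx dA IH mulr1.
elim: k => [|k IH]; last by rewrite exprS expgS PSL_ofM // IH.
rewrite expr0 expg0; apply: (mulgI (PSL_of 1%:M)).
by rewrite mulg1 -PSL_ofM ?det1 // mulmx1.
Qed.

(** The center of SL consists of scalar matrices, as its elements commute with all transvections. *)
Lemma PSL_of_eq1 A : \det A = 1 -> (PSL_of A == 1%g) = is_scalar_mx A.
Proof.
move=> dA; have -> : (PSL_of A == 1%g) = (GL_of A \in Z).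
  rewrite -(inj_eq (@subg_inj _ _)) /= subgK ?quoZ //.
  by apply/eqP/idP => [/coset_idr-> //|/coset_id]; rewrite ?normZ.
apply/idP/idP => [/centerP[_ cA]|/is_scalar_mxP[a Aa]].
  apply: scalar_mx_transvection => i j ij.
  have dT := det_transvection F ij.
  have := cA _ (GL_of_SL dT) => /(congr1 GLval).
  by rewrite !GL_MxE !GL_ofK.
apply/centerP; split; first exact: GL_of_SL.
move=> x _; apply: val_inj; change (GLval (GL_of A) *m GLval x = GLval x *m GLval (GL_of A)).
by rewrite GL_ofK // Aa scalar_mxC.
Qed.

(** To be a p-element modulo scalars is to have a scalar power [A ^+ (p ^ k)]. *)
Lemma p_elt_PSL_of p A : p \in [pchar F] -> \det A = 1 ->
  (p.-elt (PSL_of A))%g <-> exists b, char_poly A = ('X - b%:P) ^+ n.+1.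
Proof.
move=> pF dA; have p_pr := pcharf_prime pF.
have dX k : \det (A ^+ k) = 1.
  by elim: k => [|k IH]; rewrite ?det1 // exprS det_mulmx dA IH mulr1.
split=> [/p_natP[k kE]|[b /(char_poly_scalar_pX pF)[k]]].
  apply: (scalar_pX_char_poly pF (k := k)); rewrite -PSL_of_eq1 // PSL_ofX // -kE.
  by rewrite expg_order.
rewrite -PSL_of_eq1 // PSL_ofX // -order_dvdn => /pnat_dvd; apply.
by rewrite pnatX pnat_id.
Qed.

End PSLElements.

(** * Determinants and characteristic polynomials of explicit 3 x 3 matrices *)

Section Matrix3.
Variable R : comNzRingType.

Definition mat3 (a b c d e f g h i : R) : 'M[R]_3 :=
  \matrix_(k, l) nth 0 (nth [::] [:: [:: a; b; c]; [:: d; e; f]; [:: g; h; i]] k) l.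

Lemma mat3M a b c d e f g h i a' b' c' d' e' f' g' h' i' :
  mat3 a b c d e f g h i *m mat3 a' b' c' d' e' f' g' h' i' =
  mat3 (a * a' + b * d' + c * g') (a * b' + b * e' + c * h') (a * c' + b * f' + c * i')
       (d * a' + e * d' + f * g') (d * b' + e * e' + f * h') (d * c' + e * f' + f * i')
       (g * a' + h * d' + i * g') (g * b' + h * e' + i * h') (g * c' + h * f' + i * i').
Proof.
apply/matrixP => -[[|[|[|//]]] ?] [[|[|[|//]]] ?];
  by rewrite !mxE !big_ord_recl big_ord0 !mxE /= addr0 addrA.
Qed.

Lemma det_mx2 (A : 'M[R]_2) : \det A = A 0 0 * A 1 1 - A 0 1 * A 1 0.
Proof.
rewrite (expand_det_row _ 0) !big_ord_recl big_ord0 /cofactor !det_mx11 !mxE /=.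
rewrite expr0 expr1 mul1r mulN1r mulrN addr0.
by congr (_ * _ - _ * _); congr (A _ _); apply: val_inj.
Qed.

Lemma det_mat3 a b c d e f g h i : \det (mat3 a b c d e f g h i) =
  a * (e * i - f * h) - b * (d * i - f * g) + c * (d * h - e * g).
Proof.
rewrite (expand_det_row _ 0) !big_ord_recl big_ord0 /cofactor !det_mx2 !mxE /=.
rewrite /= /bump /=.
ring.
Qed.

End Matrix3.

Lemma char_poly_mat3 (R : comNzRingType) (a b c d e f g h i : R) :
  char_poly (mat3 a b c d e f g h i) =
  'X^3 - (a + e + i)%:P * 'X^2
  + (a * e - b * d + (a * i - c * g) + (e * i - f * h))%:P * 'X
  - (a * (e * i - f * h) - b * (d * i - f * g) + c * (d * h - e * g))%:P.
Proof.
rewrite /char_poly.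
have -> : char_poly_mx (mat3 a b c d e f g h i) =
    mat3 ('X - a%:P) (- b%:P) (- c%:P) (- d%:P) ('X - e%:P) (- f%:P)
         (- g%:P) (- h%:P) ('X - i%:P).
  apply/matrixP => -[[|[|[|//]]] ?] [[|[|[|//]]] ?];
    by rewrite !mxE /= ?sub0r.
rewrite det_mat3 !(polyCB, polyCD, polyCM).
ring.
Qed.

Lemma cubic_eq (R : comNzRingType) (s t u s' t' u' : R) :
  'X^3 - s%:P * 'X^2 + t%:P * 'X - u%:P = 'X^3 - s'%:P * 'X^2 + t'%:P * 'X - u'%:P ->
  [/\ s = s', t = t' & u = u'].
Proof.
move=> E; have c k := congr1 (fun q : {poly R} => q`_k) E.
split.
- by have := c 2; rewrite !coefE /= !(mulr0, mulr1, subr0, sub0r, oppr0, add0r, addr0) => /oppr_inj.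
- by have := c 1; rewrite !coefE /= !(mulr0, mulr1, subr0, sub0r, oppr0, add0r, addr0).
- by have := c 0; rewrite !coefE /= !(mulr0, mulr1, subr0, sub0r, oppr0, add0r, addr0) => /oppr_inj.
Qed.

(** * Block embedding of 3 x 3 matrices into PSL *)

Section BlockEmbedding.
Variables (F : finFieldType) (p r : nat).
Hypothesis pF : p \in [pchar F].

Definition block1 (A : 'M[F]_3) : 'M[F]_(3 + r) := block_mx A 0 0 1%:M.
Definition emb (A : 'M[F]_3) : PSL (3 + r) F := @PSL_of F r.+2 (block1 A).

Lemma det_block1 A : \det (block1 A) = \det A.
Proof. by rewrite det_ublock det1 mulr1. Qed.

Lemma block1M A B : block1 (A *m B) = block1 A *m block1 B.
Proof. by rewrite mulmx_block !mulmx0 !mul0mx !addr0 mulmx1 add0r. Qed.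

Lemma embM A B : \det A = 1 -> \det B = 1 -> emb (A *m B) = (emb A * emb B)%g.
Proof. by move=> dA dB; rewrite /emb block1M; apply: PSL_ofM; rewrite det_block1. Qed.

(* The b for which diag(b, b, b, 1, ..., 1), with r ones, is scalar of
   determinant 1. *)
Definition scalars : {set F} := [set b | (b ^+ 3 == 1) && ((r == 0%N) || (b == 1))].

Lemma char_poly_block1 A : char_poly (block1 A) = char_poly A * ('X - 1%:P) ^+ r.
Proof.
rewrite /char_poly char_block_diag_mx det_ublock; congr (_ * _).
by rewrite /char_poly_mx map_scalar_mx -rmorphB det_scalar.
Qed.

(** When [r] is positive the identity block has eigenvalue 1, which forces [b = 1]; the constant
    term of the cubic gives [b ^+ 3 = 1]. *)
Lemma p_elt_emb A : \det A = 1 ->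
  (p.-elt (emb A))%g <-> exists2 b, b \in scalars & char_poly A = ('X - b%:P) ^+ 3.
Proof.
move=> dA; have dbA : \det (block1 A) = 1 by rewrite det_block1.
apply: (iff_trans (@p_elt_PSL_of F r.+2 p (block1 A) pF dbA)).
rewrite char_poly_block1; split=> [[b bE]|[b]].
  have b1 : (r == 0%N) || (b == 1).
    case: (r) bE => [//|k] /(congr1 (fun q => q.[1])).
    rewrite !hornerE subrr expr0n mulr0 => /esym/eqP.
    by rewrite expf_eq0 /= subr_eq0 eq_sym.
  have cA : char_poly A = ('X - b%:P) ^+ 3.
    have [r0|r0] := eqVneq r 0%N; first by move: bE; rewrite r0 mulr1.
    move: b1 bE; rewrite (negbTE r0) /= => /eqP ->.
    rewrite -[r.+3]/(3 + r)%N exprD => /mulIf; apply.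
    by rewrite expf_neq0 ?polyXsubC_eq0.
  exists b => //; rewrite inE b1 andbT.
  have := char_poly_det A; rewrite cA dA -horner_coef0 !hornerE ?sub0r.
  move=> b3; apply/eqP/(mulrI (unitrX 3 (unitrN1 F))).
  by rewrite mulr1 -exprNn.
rewrite inE => /andP[_ b1] ->; exists b; rewrite -[r.+3]/(3 + r)%N exprD.
by congr (_ * _); case/orP: b1 => /eqP ->.
Qed.

End BlockEmbedding.

(** * Counting p-elements modulo p *)

Section Counting.
Variables (F : finFieldType) (p r : nat).
Hypothesis pF : p \in [pchar F].
Local Notation L := (scalars F r).

Hypothesis p_dvd_F : (p %| #|F|)%N.

Let qF0 : #|F|%:R = 0 :> F.
Proof. by apply/eqP; rewrite -(dvdn_pcharf pF). Qed.

Let p_pr : prime p := pcharf_prime pF.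

(** The set is a subgroup of the multiplicative group, so its order divides [#|F|.-1], which is
    prime to [p]. *)
Lemma card_scalars_neq0 : #|L|%:R != 0 :> F.
Proof.
pose U := [set u : {unit F} | val u \in L].
have gU : group_set U.
  apply/group_setP; split=> [|u v]; rewrite !inE /= ?expr1n ?eqxx ?orbT //.
  rewrite exprMn => /andP[/eqP-> u1] /andP[/eqP-> v1]; rewrite mulr1 eqxx /=.
  case/orP: u1 => [->//|/eqP->]; case/orP: v1 => [->//|/eqP->].
  by rewrite mulr1 eqxx orbT.
have cU : #|L| = #|U|.
  rewrite -(card_imset _ val_inj); apply: eq_card => b; apply/idP/imsetP.
    move=> bL; have bu : b \is a GRing.unit.
      rewrite unitfE; apply: contraTneq bL => ->.
      by rewrite inE expr0n eq_sym oner_eq0.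
    by exists (FinRing.unit F bu); first by rewrite inE.
  by case=> u; rewrite inE => uL ->.
have : (#|U| %| #|F|.-1)%N.
  rewrite -card_finField_unit.
  by rewrite (cardSg (G := [group of [set: {unit F}]]) (H := Group gU)) ?finset.subsetT.
rewrite cU -(dvdn_pcharf pF) => Ud; apply/negP => pU.
have : (p %| 1)%N.
  rewrite -(dvdn_addr _ (dvdn_trans pU Ud)) addn1 prednK; last first.
    by apply/card_gt0P; exists 0.
  by rewrite (dvdn_pcharf pF) qF0.
by rewrite dvdn1 => /eqP p1; have := p_pr; rewrite p1.
Qed.

(** The cube of [b - b'] is a combination of the difference of the cubes and of [3 * (b - b')]; this
    treats all characteristics at once, 3 included. *)
Lemma scalars_inj b b' : b \in L -> b' \in L -> 3%:R * b = 3%:R * b' -> b = b'.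
Proof.
rewrite !inE => /andP[/eqP b3 _] /andP[/eqP b'3 _] e.
apply/eqP; rewrite -subr_eq0; suff : (b - b') ^+ 3 == 0 by rewrite expf_eq0.
have -> : (b - b') ^+ 3 = (b ^+ 3 - b' ^+ 3) - b * b' * (3%:R * b - 3%:R * b') by ring.
by rewrite e b3 b'3 !subrr mulr0 subrr.
Qed.

(** The constant terms agree already, so only the other two coefficients are compared. *)
Lemma char_poly_mat3_cube (a b c d e f g h i z : F) : z ^+ 3 = 1 ->
    a * (e * i - f * h) - b * (d * i - f * g) + c * (d * h - e * g) = 1 ->
  char_poly (mat3 a b c d e f g h i) = ('X - z%:P) ^+ 3 <->
  a + e + i = 3%:R * z /\
  a * e - b * d + (a * i - c * g) + (e * i - f * h) = 3%:R * z ^+ 2.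
Proof.
move=> z3 dA; rewrite char_poly_mat3 dA.
have -> : ('X - z%:P) ^+ 3 =
    'X^3 - (3%:R * z)%:P * 'X^2 + (3%:R * z ^+ 2)%:P * 'X - 1%:P.
  transitivity ('X^3 - (3%:R * z)%:P * 'X^2 + (3%:R * z ^+ 2)%:P * 'X - (z ^+ 3)%:P).
    by rewrite !(rmorphM, rmorphXn, rmorph_nat) /=; ring.
  by rewrite z3.
by split=> [/cubic_eq[-> ->]|[-> ->]].
Qed.

Definition transl (x : F * F) : 'M[F]_3 := mat3 1 0 x.1 0 1 x.2 0 0 1.
Definition cycle3 : 'M[F]_3 := mat3 0 1 0 0 0 1 1 0 0.

Lemma det_transl x : \det (transl x) = 1. Proof. rewrite det_mat3; ring. Qed.
Lemma det_cycle3 : \det cycle3 = 1. Proof. rewrite det_mat3; ring. Qed.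

Lemma translD x y : transl (x + y) = transl x *m transl y.
Proof. by rewrite mat3M /=; congr mat3; rewrite /=; ring. Qed.

Definition emb_transl x := emb r (transl x).

Lemma emb_translD : {morph emb_transl : x y / x + y >-> (x * y)%g}.
Proof. by move=> x y; rewrite /emb_transl translD embM ?det_transl. Qed.

Lemma emb_transl_inj : injective emb_transl.
Proof.
move=> x y; rewrite -[x](subrK y) emb_translD => /(canRL (mulgK _)).
rewrite mulgV => /eqP.
rewrite PSL_of_eq1; last by rewrite det_block1 det_transl.
case/is_scalar_mxP => a /matrixP e.
have {}e (i j : 'I_3) : transl (x - y) i j = a *+ (i == j).
  rewrite -[LHS](block_mxEul (transl (x - y)) 0 0 (1%:M : 'M_r)).
  by rewrite [LHS]e mxE.
(* The coordinates of [x - y] are off-diagonal entries of a scalar matrix. *)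
have := e 0 2%:R; have := e 1 2%:R; rewrite !mxE /= => x2 x1.
suff -> : x - y = 0 by rewrite add0r.
exact: (congr2 pair x1 x2).
Qed.

Local Notation g := (emb r cycle3).

(** The characteristic polynomial of the 3 x 3 block is [X^3 - x.1 X^2 - x.2 X - 1], so each [b]
    prescribes [x]. *)
Lemma p_elt_transl_cycle x :
  (p.-elt (emb_transl x * g))%g <->
  exists2 b, b \in L & x = (3%:R * b, - (3%:R * b ^+ 2)).
Proof.
have dA : \det (transl x *m cycle3) = 1.
  by rewrite det_mulmx det_transl det_cycle3 mulr1.
rewrite /emb_transl -embM ?det_transl ?det_cycle3 //.
apply: (iff_trans (p_elt_emb r pF dA)).
split=> -[b bL].
all: have b3 : b ^+ 3 = 1 by move: bL; rewrite inE => /andP[/eqP].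
  rewrite mat3M => /(char_poly_mat3_cube b3)[|e1 e2]; first by ring.
  exists b => //; rewrite [x]surjective_pairing -e1 -e2.
  by congr pair; ring.
move=> xE; exists b => //; rewrite mat3M; apply/(char_poly_mat3_cube b3); first by ring.
by rewrite xE /=; split; ring.
Qed.

(** The block has trace [x.1 * y.1 + x.2 + y.2] and second coefficient [x.2 * y.2 - x.1 - y.1]. The
    trace determines [x.2]; substitution leaves an equation linear in [x.1]. *)
Lemma p_elt_transl_cycle2 x y :
  (p.-elt (emb_transl x * g * (emb_transl y * g)))%g <->
  exists2 b, b \in L &
    x.2 = 3%:R * b - y.2 - x.1 * y.1 /\
    x.1 * (y.1 * y.2 + 1) = y.2 * (3%:R * b - y.2) - y.1 - 3%:R * b ^+ 2.
Proof.
have dA z : \det (transl z *m cycle3) = 1.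
  by rewrite det_mulmx det_transl det_cycle3 mulr1.
rewrite /emb_transl -!embM ?dA ?det_transl ?det_cycle3 //.
have dB : \det (transl x *m cycle3 *m (transl y *m cycle3)) = 1.
  by rewrite det_mulmx !dA mulr1.
apply: (iff_trans (p_elt_emb r pF dB)).
split=> -[b bL].
all: have b3 : b ^+ 3 = 1 by move: bL; rewrite inE => /andP[/eqP].
  rewrite !mat3M => /(char_poly_mat3_cube b3)[|e1 e2]; first by ring.
  exists b => //; rewrite -e1.
  have -> : 3%:R * b ^+ 2 = y.2 * x.2 - x.1 - y.1 by rewrite -e2; ring.
  by split; ring.
move=> [e1 e2]; exists b => //; rewrite !mat3M; apply/(char_poly_mat3_cube b3); first by ring.
split; first by rewrite e1; ring.
have -> : 3%:R * b ^+ 2 = y.2 * (3%:R * b - y.2) - y.1 - x.1 * (y.1 * y.2 + 1).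
  by rewrite e2; ring.
by rewrite e1; ring.
Qed.

Lemma card_p_elt_transl_cycle :
  #|[set x | (p.-elt (emb_transl x * g))%g]| = #|L|.
Proof.
pose f b : F * F := (3%:R * b, - (3%:R * b ^+ 2)).
have f_inj : {in L &, injective f} by move=> b b' bL b'L [/(scalars_inj bL b'L)].
rewrite -(card_in_imset f_inj); apply: eq_card => x; rewrite inE.
by apply/idP/imsetP => /p_elt_transl_cycle.
Qed.

(** For [d = 0] there are either no solutions or [#|F|] of them, and [#|F|] vanishes in [F]. *)
Lemma card_linear_root (d e : F) : #|[set a | a * d == e]|%:R = (d != 0)%:R :> F.
Proof.
have [->|d0] /= := eqVneq d 0.
  have -> : [set a : F | a * 0 == e] = if 0 == e then [set: F] else finset.set0.
    by apply/setP => a; rewrite inE mulr0; case: eqP; rewrite inE.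
  by case: eqP; rewrite ?cardsT ?cards0 ?qF0.
rewrite (_ : [set a | a * d == e] = [set e / d]) ?cards1 //.
by apply/setP => a; rewrite !inE eq_sym -(can2_eq (divfK d0) (mulfK d0)) eq_sym.
Qed.

(** The hyperbola [x * y = -1] has [#|F| - 1] points, so its complement in the plane has 1 modulo
    [p]. *)
Lemma sum_nonzero_quadric : \sum_(x : F) \sum_(y : F) (x * y + 1 != 0)%:R = 1 :> F.
Proof.
have sumF (a : F) : \sum_(x : F) a = 0 by rewrite sumr_const -mulr_natr qF0 mulr0.
have E (b : bool) : (~~ b)%:R = 1 - b%:R :> F by case: b; rewrite ?subrr ?subr0.
have in_sum (x : F) : \sum_(y : F) (x * y + 1 != 0)%:R = - (x != 0)%:R :> F.
  under eq_bigr => y _ do rewrite E.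
  rewrite sumrB sumF sub0r -(card_linear_root x (-1)); congr (- _).
  rewrite -sum1dep_card natr_sum [RHS]big_mkcond; apply: eq_bigr => y _.
  by rewrite addr_eq0 mulrC; case: eqP.
under eq_bigr => x _ do rewrite in_sum E opprB.
by rewrite sumrB sumF subr0 (bigD1 0) //= eqxx big1 ?addr0 // => x /negbTE ->.
Qed.

(** The pairs are parametrized by [b], [y] and [a = x.1], where [b] is recovered from the trace by
    [scalars_inj]. For fixed [b], counting [a] and then [y] gives 1 modulo [p]. *)
Lemma card_p_elt_transl_cycle2 :
  #|[set x : _ * _ | (p.-elt (emb_transl x.1 * g * (emb_transl x.2 * g)))%g]|%:R
  = #|L|%:R :> F.
Proof.
pose cond b (y : F * F) a :=
  a * (y.1 * y.2 + 1) == y.2 * (3%:R * b - y.2) - y.1 - 3%:R * b ^+ 2.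
pose B : {set F * (F * F) * F} := [set z | (z.1.1 \in L) && cond z.1.1 z.1.2 z.2].
pose f (z : F * (F * F) * F) : (F * F) * (F * F) :=
  ((z.2, 3%:R * z.1.1 - z.1.2.2 - z.2 * z.1.2.1), z.1.2).
have BP z : (z \in B) = (z.1.1 \in L) && cond z.1.1 z.1.2 z.2 by rewrite finset.in_set.
have f_inj : {in B &, injective f}.
  move=> [[b y] a] [[b' y'] a']; rewrite !BP /= => /andP[bL _] /andP[b'L _].
  by move=> [-> e yE]; move: e; rewrite yE => /addIr/addIr/(scalars_inj bL b'L) ->.
have -> : #|[set x : _ * _ | (p.-elt (emb_transl x.1 * g * (emb_transl x.2 * g)))%g]| = #|B|.
  rewrite -(card_in_imset f_inj); apply: eq_card => -[x y]; rewrite inE /=.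
  apply/idP/imsetP => [/p_elt_transl_cycle2[b bL [e1 e2]]|[[[b y'] a]]].
    exists (b, y, x.1); first by rewrite BP /= bL /cond e2 eqxx.
    by rewrite /f /= -e1 -surjective_pairing.
  rewrite BP /= => /andP[bL /eqP e] [-> ->].
  by apply/p_elt_transl_cycle2; exists b.
rewrite -sum1dep_card natr_sum big_mkcond /=.
transitivity (\sum_(b : F) \sum_(y : F * F) \sum_(a : F)
   if (b \in L) && cond b y a then 1 else 0 : F).
  by rewrite pair_bigA pair_bigA.
transitivity (\sum_(b : F) (if b \in L then 1 else 0 : F)); last first.
  by rewrite -big_mkcond sumr_const.
apply: eq_bigr => b _.
case: (b \in L); last by rewrite big1 // => y _; rewrite big1.
rewrite -[RHS]sum_nonzero_quadric [RHS]pair_bigA; apply: eq_bigr => y _ /=.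
rewrite -(card_linear_root _ (y.2 * (3%:R * b - y.2) - y.1 - 3%:R * b ^+ 2)).
by rewrite -sum1dep_card natr_sum [RHS]big_mkcond.
Qed.

End Counting.

Local Open Scope complex_scope.

Theorem corollary7p3 (R : realType) (n p m : nat) (F : finFieldType)
    (n_ge1 : (1 <= n)%N) (p_prime : prime p) (m_ge1 : (1 <= m)%N)
    (cardF : #|F| = (p ^ m)%N) :
  exists (M : {group PSL n.*2.+1 F}) (abM : abelian M)
         (omega : dual R[i] (subg_of M) -> dual R[i] (subg_of M) -> R[i])
         (omegaP : normalized_2cocycle omega),
  forall (L : fieldExtType rat) (sigma : {rmorphism L -> R[i]}),
    ~ exists X : set (group_alg R[i] (PSL n.*2.+1 F)),
        hopf_order (number_ring sigma) (twisted_group_hopf abM omegaP) X.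
Proof.
(* For [n = r.+1] the size [n.*2.+1] is convertible to [3 + r.*2]: a 3 x 3 block followed by [r.*2]
   ones. *)
case: n n_ge1 => // r _.
have pF : p \in [pchar F] := card_finPcharP cardF p_prime.
have p_dvd : (p %| #|F|)%N by rewrite cardF dvdn_exp.
have [||M [abM [omega [omegaP noX]]]] := @twist_without_order R[i] F
  (PSL (3 + r.*2) F) (emb_transl r.*2) (emb r.*2 (cycle3 F)) p
  (@emb_translD F r.*2) (@emb_transl_inj F r.*2) p_prime p_dvd.
(* Divisibility by [p] is vanishing in [F], where both counts equal the order of the group of
   [scalars]. *)
- by rewrite (dvdn_pcharf pF) (card_p_elt_transl_cycle r.*2 pF) (card_scalars_neq0 _ pF p_dvd).
- rewrite (dvdn_pcharf pF) (card_p_elt_transl_cycle2 r.*2 pF p_dvd).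
  exact: (card_scalars_neq0 _ pF p_dvd).
exists M, abM, omega, omegaP => L sigma [X ordX].
exact: (noX (number_ring sigma) X (@number_ring_algint R[i] L sigma) ordX).
Qed.
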